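(* Let $\beta\in(0,1]$ and consider the SAMBA process with learning-rate function $$\alpha(p)=\frac{\beta}{\log(e-\log p)}.$$ Then $(\mathbf p(t))_{t\in\mathbb Z_+}$ is a Markov chain, with probability $1$ we have $p_{a^\star}(t)\to1$ as $t\to\infty$, and for every $T\in\mathbb N$, $$\mathrm{Rg}(T)\le \frac{N}{\beta\Delta}\log T\cdot\log(e+\log T)+Q+1,$$ where $Q:=\sum_{t=0}^\infty\mathbb P\big(p_{a^\star}(t)\le\frac12\big)$.
   Context: Bandit model: $\mathcal A$ is a finite set of arms, $N=|\mathcal A|$. For each arm $a$ and time $t\in\mathbb Z_+=\{0,1,2,\dots\}$, $R_a(t)\in\{0,1\}$ is a Bernoulli random variable with mean $r_a\in[0,1]$; all $R_a(t)$ are independent. There is a unique optimal arm $a^\star$ with $r^\star:=r_{a^\star}>r_a$ for all $a\ne a^\star$, and $\Delta:=r^\star-\max_{a\neq a^\star}r_a>0$. SAMBA process with learning-rate function $\alpha$: $\mathbf p(0)$ is a probability vector on $\mathcal A$ with all entries positive. At each time $t$, let $a_\star(t)$ be an arm maximizing $p_a(t)$ (ties broken uniformly at random) and $p_\star(t)=p_{a_\star(t)}(t)$. Exactly one arm is played at time $t$, arm $a$ with conditional probability $p_a(t)$ given the past (using independent randomization); $I_a(t)$ is the indicator that $a$ is played, $I_\star(t)=I_{a_\star(t)}(t)$, $R_\star(t)=R_{a_\star(t)}(t)$. For each $a\ne a_\star(t)$, $$p_a(t+1)=p_a(t)+\alpha(p_a(t))\,p_a(t)^2\Big[\frac{I_a(t)R_a(t)}{p_a(t)}-\frac{I_\star(t)R_\star(t)}{p_\star(t)}\Big],$$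 and $p_{a_\star(t)}(t+1)=1-\sum_{a\ne a_\star(t)}p_a(t+1)$. Regret: $\mathrm{Rg}(T)=r^\star T-\mathbb E\big[\sum_{t=0}^{T-1}\sum_{a\in\mathcal A}I_a(t)R_a(t)\big]$. *)

(* Defs.v *)
From HB Require Import structures.
From mathcomp Require Import all_boot all_order all_algebra.
From mathcomp Require Import all_classical all_reals all_analysis.
Import Order.TTheory GRing.Theory Num.Theory.
Import numFieldNormedType.Exports.

Set Implicit Arguments.
Unset Strict Implicit.
Unset Printing Implicit Defensive.

Local Open Scope ring_scope.
Local Open Scope classical_set_scope.

Definition preimage_class (Omega T : Type) (f : Omega -> T) (D : set (set T))
  : set (set Omega) := [set f @^-1` B | B in D].

Definition mutually_independent (d : measure_display) (Omega : measurableType d)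
  (R : realType) (P : probability Omega R) (I : eqType)
  (E : I -> set (set Omega)) : Prop :=
  forall (s : seq I) (e : I -> set Omega),
    uniq s -> (forall i, i \in s -> E i (e i)) ->
    P (\bigcap_(i in [set` s]) e i) = (\prod_(i <- s) P (e i))%E.

Definition uniform01 (d : measure_display) (Omega : measurableType d)
  (R : realType) (P : probability Omega R) (X : Omega -> R) : Prop :=
  measurable_fun setT X /\
  forall x : R, 0 <= x <= 1 -> P [set w | X w <= x] = x%:E.

Definition bernoulli_rv (d : measure_display) (Omega : measurableType d)
  (R : realType) (P : probability Omega R) (q : R) (B : Omega -> bool) : Prop :=
  measurable [set w | B w] /\ P [set w | B w] = q%:E.

(* (X_t)_t is a time-homogeneous Markov chain on the state space S endowed
   with its discrete sigma-algebra: there is a transition function K such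
   that for all t and all sets B_0, ..., B_{t+1} of states,
   P(X_0 in B_0, ..., X_{t+1} in B_{t+1})
     = E[ 1{X_0 in B_0, ..., X_t in B_t} K(X_t, B_{t+1}) ]. *)
Definition markov_chain (d : measure_display) (Omega : measurableType d)
  (R : realType) (P : probability Omega R) (S : Type)
  (X : nat -> Omega -> S) : Prop :=
  exists K : S -> set S -> R,
    (forall x B, 0 <= K x B) /\
    forall (t : nat) (B : nat -> set S),
      P [set w | forall s, (s <= t.+1)%N -> B s (X s w)]
      = (\int[P]_(w in [set w | forall s, (s <= t)%N -> B s (X s w)])
           (K (X t w) (B t.+1))%:E)%E.

Section Samba.
Variables (R : realType) (A : finType).

Definition samba_alpha (beta : R) (p : R) : R :=
  beta / ln (expR 1 - ln p).

(* Arm selection by inverse transform sampling with a uniform u: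
   arms are laid out on [0,1) in the order of enum A, arm a occupying
   [cum p a, cum p a + p a). *)
Definition cum (p : A -> R) (a : A) : R :=
  \sum_(b : A | (enum_rank b < enum_rank a)%N) p b.

Definition played (p : A -> R) (u : R) (a : A) : bool :=
  (cum p a <= u) && (u < cum p a + p a).

(* The set of maximizing arms and the uniformly random tie-break using v. *)
Definition argmax_set (p : A -> R) : seq A :=
  [seq a <- enum A | [forall b, p b <= p a]].

Definition leader (a0 : A) (p : A -> R) (v : R) : A :=
  nth a0 (argmax_set p) (Num.truncn (v * (size (argmax_set p))%:R)).

Definition samba_step (alpha : R -> R) (a0 : A) (p : A -> R) (u v : R)
  (rew : A -> bool) : A -> R :=
  let s := leader a0 p v in
  let upd := fun a : A =>
     p a + alpha (p a) * p a ^+ 2 *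
       ((played p u a && rew a)%:R / p a - (played p u s && rew s)%:R / p s) in
  fun a => if a == s then 1 - \sum_(b | b != s) upd b else upd a.

Fixpoint samba (alpha : R -> R) (a0 : A) (p0 : A -> R) (Omega : Type)
  (Rew : A -> nat -> Omega -> bool) (U V : nat -> Omega -> R) (t : nat)
  (w : Omega) : A -> R :=
  match t with
  | 0 => p0
  | t'.+1 => samba_step alpha a0 (samba alpha a0 p0 Rew U V t' w)
               (U t' w) (V t' w) (fun a => Rew a t' w)
  end.

Definition samba_gain (alpha : R -> R) (a0 : A) (p0 : A -> R) (Omega : Type)
  (Rew : A -> nat -> Omega -> bool) (U V : nat -> Omega -> R) (t : nat)
  (w : Omega) (a : A) : R :=
  (played (samba alpha a0 p0 Rew U V t w) (U t w) a && Rew a t w)%:R.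

End Samba.

Definition samba_index (A : finType) : eqType := ((A * nat) + nat + nat)%type.

Definition samba_sources (d : measure_display) (Omega : measurableType d)
  (R : realType) (A : finType) (Rew : A -> nat -> Omega -> bool)
  (U V : nat -> Omega -> R) (i : samba_index A) : set (set Omega) :=
  match i with
  | inl (inl (a, t)) => preimage_class (Rew a t) setT
  | inl (inr t) => preimage_class (U t) (@measurable _ R)
  | inr t => preimage_class (V t) (@measurable _ R)
  end.

(* Main.v *)
(* At every time the next state is determined by the leader, the arm selected by
   the uniform variable and the rewards, so the state process takes finitely many
   values and, by independence, every expectation at time t is a finite weighted
   sum over the outcome paths of length t.

   Almost sure convergence. Put y := 1 - p_{a*}. It is a nonnegative
   supermartingale, hence the expected drifts -E[y(t+1) - y(t)] are summable. The
   one-step drift of 1 / p_{a*} is at most a constant times that of p_{a*}: when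
   p_{a*} is small the learning rate is small against the gap, and otherwise the
   drift of p_{a*} is bounded below. So E[1 / p_{a*}(t)] is bounded; as the drift
   of p_{a*} is bounded below whenever p_{a*} stays away from 0 and 1, E[y(t)]
   tends to 0, and Doob's maximal inequality turns this into y(t) -> 0 a.s.

   Regret. With n := N - 1 and kappa := beta / log(e + log T), the concave
   potential n / (kappa Delta) * log(1 + (T / n) y) decreases in mean by at least
   the instantaneous regret, up to n / T and to the indicator of p_{a*} <= 1/2.
   Summing over t < T leaves n / (kappa Delta) * log(1 + T / n) + n + Q, which is
   below the claimed bound as soon as n <= T log T; in the remaining range of N
   the bound exceeds T. *)

Require Import Defs.
From HB Require Import structures.
From mathcomp Require Import all_boot all_order all_algebra.
From mathcomp Require Import all_classical all_reals all_analysis.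
From mathcomp Require Import measurable_realfun measurable_fun_approximation.
From mathcomp Require Import ring lra.
Import Order.TTheory GRing.Theory Num.Theory.
Import numFieldNormedType.Exports.
Local Open Scope ring_scope.
Local Open Scope classical_set_scope.

Set Implicit Arguments.
Unset Strict Implicit.
Unset Printing Implicit Defensive.

(** * The uniform law *)

Section UniformLaw.
Context {R : realType}.

Definition unif01 (B : set R) : R :=
  fine (lebesgue_measure (B `&` `[0, 1])).

Lemma unif01_itv_co (a b : R) :
  0 <= a -> a <= b -> b <= 1 -> unif01 [set u | (a <= u) && (u < b)] = b - a.
Proof.
move=> a0 ab b1; rewrite /unif01.
have -> : [set u : R | (a <= u) && (u < b)] `&` `[0, 1] = `[a, b[.
  apply/seteqP; split => x /=; rewrite !in_itv /=; first by case=> ->.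
  by move=> /andP[h1 h2]; split; [rewrite h1 h2|apply/andP; split; lra].
by rewrite lebesgue_measure_itv /= lte_fin; case: ltP => //= ba; lra.
Qed.

(** Inside [[0, 1]] only the point 1 can remain, a null set. This discards the values of the
    tie-break variable for which the index in [leader] runs past the end of the list. *)
Lemma unif01_ge1 (B : set R) : measurable B -> (forall u, B u -> 1 <= u) -> unif01 B = 0.
Proof.
move=> mB B1; rewrite /unif01.
suff -> : lebesgue_measure (B `&` `[0, 1]) = 0%E by [].
apply: (@subset_measure0 _ _ _ (@lebesgue_measure R) _ [set 1]) => //.
- exact: measurableI.
- by move=> u /= [/B1 u1]; rewrite in_itv /= => /andP[_ ?]; apply/eqP; rewrite eq_le; apply/andP.
- exact: lebesgue_measure_set1.
Qed.

Lemma unif01_ge0 (B : set R) : 0 <= unif01 B.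
Proof. exact: fine_ge0. Qed.

Lemma unif01T : unif01 setT = 1.
Proof. by rewrite /unif01 setTI lebesgue_measure_itv /= lte_fin ltr01 sube0. Qed.

Lemma unif01_fin_num (B : set R) : measurable B ->
  lebesgue_measure (B `&` `[0, 1]) \is a fin_num.
Proof.
move=> mB; rewrite ge0_fin_numE //.
rewrite (@le_lt_trans _ _ (lebesgue_measure (`[0, 1]%classic : set R))) //.
  by apply: le_measure; rewrite ?inE //; exact: measurableI.
by rewrite lebesgue_measure_itv /= lte_fin ltr01 ltry.
Qed.

Lemma unif01U (B C : set R) : measurable B -> measurable C -> B `&` C = set0 ->
  unif01 (B `|` C) = unif01 B + unif01 C.
Proof.
move=> mB mC BC0; rewrite /unif01 setIUl measureU; first last.
- by rewrite setIACA BC0 set0I.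
- exact: measurableI.
- exact: measurableI.
by rewrite fineD //; exact: unif01_fin_num.
Qed.

(** Additivity over the fibres of a finitely valued map; it gives the total and marginal masses of
    the leader and arm laws. *)
Lemma unif01_fibers (T : finType) (f : R -> T) (Q : pred T) :
  (forall t, measurable [set u | f u = t]) ->
  \sum_(t | Q t) unif01 [set u | f u = t] = unif01 [set u | Q (f u)].
Proof.
move=> mf.
(* Induction on a duplicate-free list of values; measurability is carried along because each use of
   additivity asks for it. *)
suff H (s : seq T) : uniq s -> measurable [set u | Q (f u) && (f u \in s)] /\
    \sum_(t <- s | Q t) unif01 [set u | f u = t] =
    unif01 [set u | Q (f u) && (f u \in s)].
  have [_ ->] := H _ (index_enum_uniq T).
  congr unif01; apply/seteqP; split => u /=; first by case/andP.
  by move=> ->; rewrite mem_index_enum.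
elim: s => [_|t s IH /= /andP[ts us]].
  have -> : [set u | Q (f u) && (f u \in [::])] = set0.
    by apply/seteqP; split => u //=; rewrite andbF.
  by rewrite big_nil /unif01 set0I measure0.
have [mS IHs] := IH us; rewrite big_cons.
have [Qt|Qt] := boolP (Q t); last first.
  rewrite (_ : [set u | Q (f u) && (f u \in t :: s)] =
    [set u | Q (f u) && (f u \in s)]) //.
  apply/seteqP; split => u /=; rewrite inE; last by case/andP=> -> ->; rewrite orbT.
  by case/andP=> Qu /predU1P[ut|->]; [rewrite ut (negbTE Qt) in Qu|rewrite Qu].
have -> : [set u | Q (f u) && (f u \in t :: s)] =
    [set u | f u = t] `|` [set u | Q (f u) && (f u \in s)].
  apply/seteqP; split => u /=; rewrite inE.
    by case/andP=> -> /predU1P[->|->]; [left|right].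
  by case=> [->|/andP[-> ->]]; rewrite ?Qt ?eqxx ?orbT.
split; first exact: measurableU.
rewrite unif01U ?IHs //; apply/seteqP; split => u //= [-> /andP[_]].
by rewrite (negbTE ts).
Qed.

Variables (d : measure_display) (Omega : measurableType d).
Variable P : probability Omega R.

(** [uniform01] prescribes only the distribution function on [[0, 1]]. The image law and the
    restricted Lebesgue measure agree on the open right half-lines, a generating family stable under
    intersection, hence on all Borel sets. *)
Lemma uniform01_law (X : Omega -> R) (B : set R) :
  uniform01 P X -> measurable B -> P (X @^-1` B) = (unif01 B)%:E.
Proof.
move=> [mX uX] mB.
have m01 : measurable (`[0, 1]%classic : set R) by [].
have -> : (unif01 B)%:E = mrestr (@lebesgue_measure R) m01 B.
  by rewrite /unif01 fineK // unif01_fin_num.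
(* Outside [[0, 1]] the distribution function is forced by monotonicity from its values 0 at 0 and 1
   at 1. *)
have PX (x : R) : P [set w | X w <= x] = (if x < 0 then 0 else if x <= 1 then x else 1)%:E.
  have mS (z : R) : measurable [set w | X w <= z].
    by rewrite -[X in measurable X]setTI; apply: measurable_fun_le.
  case: ltP => x0.
    apply: (@subset_measure0 _ _ _ P _ [set w | X w <= 0]) => //.
    - by move=> w /= /le_trans; apply; exact: ltW.
    - by apply: (uX 0); rewrite lexx ler01.
  have [x1|x1] := leP x 1; first by rewrite uX // x0.
  apply/eqP; rewrite eq_le probability_le1 //= -(uX 1) ?ler01 ?lexx //.
  by apply: le_measure; rewrite ?inE // => w /= /le_trans; apply; exact: ltW.
have mX' : measurable_fun [set: Omega] (X : Omega -> measurableTypeR R) := mX.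
pose m1 : {measure set (measurableTypeR R) -> \bar R} :=
  pushforward P (X : Omega -> measurableTypeR R).
pose m2 : {measure set (measurableTypeR R) -> \bar R} := mrestr (@lebesgue_measure R) m01.
rewrite -[LHS]/(m1 mX' B) -[RHS]/(m2 B).
apply: (@measure_unique _ R (measurableTypeR R) (@RGenOInfty.G R)
  (fun n => `](- n%:R), +oo[%classic)) => //.
- exact: RGenOInfty.measurableE.
- move=> _ _ [x ->] [y ->]; exists (Num.max x y).
  apply/seteqP; split => z /=; rewrite !in_itv /= !andbT gt_max.
    by case=> -> ->.
  by move/andP.
- by move=> n; eexists.
- apply/seteqP; split => // x _; exists (Num.truncn `|x|).+1 => //=.
  rewrite in_itv /= andbT ltrNl (le_lt_trans (ler_norm _)) // normrN.
  exact: truncnS_gt.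
- move=> _ [x ->]; rewrite /pushforward /= /mrestr.
  transitivity (P (~` [set w | X w <= x])).
    congr (P _); apply/seteqP; split => w /=;
      by rewrite in_itv /= andbT ltNge => /negP.
  rewrite probability_setC ?PX; last first.
    by rewrite -[X in measurable X]setTI; apply: measurable_fun_le.
  have [x0|x0] := ltP x 0.
    rewrite setIidr; last first.
      by move=> z /=; rewrite !in_itv /= andbT => /andP[z0 _]; exact: lt_le_trans z0.
    by rewrite lebesgue_measure_itv /= lte_fin ltr01 -EFinB.
  have -> : `]x, +oo[ `&` `[0, 1] = `]x, 1]%classic.
    apply/seteqP; split => z /=; rewrite !in_itv /= ?andbT; first by case=> -> /andP[].
    by move=> /andP[xz z1]; rewrite xz z1 (le_trans x0 (ltW xz)).
  rewrite lebesgue_measure_itv /= lte_fin -EFinB.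
  by have [x1|x1|->] := ltgtP x 1; rewrite ?subrr.
- move=> k; apply: (le_lt_trans (probability_le1 P _)); last exact: ltry.
  by rewrite -[X in measurable X]setTI; exact: mX.
Qed.
End UniformLaw.

(** * Outcome paths and their law *)

Section Paths.
Variables (R : realType) (A : finType).
Variables (alpha : R -> R) (a0 : A) (p0 : A -> R) (r : A -> R).

(* An outcome records the leader, the set of arms whose cell contains the
   uniform variable, and the rewards of all arms. *)
Definition outcome : finType := (A * {ffun A -> bool} * {ffun A -> bool})%type.

Definition observe (x : A -> R) (u v : R) (rew : A -> bool) : outcome :=
  (leader a0 x v, [ffun a => played x u a], [ffun a => rew a]).

Definition wins (o : outcome) (a : A) : bool := o.1.2 a && o.2 a.

Definition update (x : A -> R) (o : outcome) (a : A) : R :=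
  x a + alpha (x a) * x a ^+ 2 *
    ((wins o a)%:R / x a - (wins o o.1.1)%:R / x o.1.1).

Definition outcome_step (x : A -> R) (o : outcome) : A -> R :=
  fun a => if a == o.1.1 then 1 - \sum_(b | b != o.1.1) update x o b
           else update x o a.

(** The real-valued sources enter a step only through the finite datum [observe]. *)
Lemma samba_stepE x u v rew :
  samba_step alpha a0 x u v rew = outcome_step x (observe x u v rew).
Proof.
apply/funext => a; rewrite /samba_step /outcome_step /update /wins /=.
by rewrite !ffunE; case: ifP => // _; congr (1 - _); apply: eq_bigr => b _; rewrite !ffunE.
Qed.

Definition lead_weight x s : R := unif01 [set v | leader a0 x v = s].
Definition play_weight x (pi : {ffun A -> bool}) : R :=
  unif01 [set u : R | [ffun a => played x u a] = pi].
Definition reward_weight (rho : {ffun A -> bool}) : R :=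
  \prod_a (if rho a then r a else 1 - r a).
(** The conditional law of the next outcome given the state [x]. It is a product because leader, arm
    and rewards read independent sources. *)
Definition outcome_weight x (o : outcome) : R :=
  lead_weight x o.1.1 * play_weight x o.1.2 * reward_weight o.2.

(** The leader depends on [v] through an integer part, whose level sets are differences of
    half-lines. The union is countable: every index beyond the list returns the default arm. *)
Lemma measurable_leader (x : A -> R) (s : A) :
  measurable [set v : R | leader a0 x v = s].
Proof.
set k := size (argmax_set x).
have mge n : measurable [set v : R | (n <= Num.truncn (v * k%:R))%N].
  case: n => [|n]; first by rewrite [X in measurable X](_ : _ = setT) //; apply/seteqP; split.
  have -> : [set v : R | (n < Num.truncn (v * k%:R))%N] =
            [set v : R | n.+1%:R <= v * k%:R].
    by apply/seteqP; split => v /=; rewrite truncn_gt_nat.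
  rewrite -[X in measurable X]setTI; apply: measurable_fun_le => //.
  by apply: measurable_funM.
have -> : [set v : R | leader a0 x v = s] =
  \bigcup_(n in [set n | nth a0 (argmax_set x) n = s])
     ([set v : R | (n <= Num.truncn (v * k%:R))%N] `\`
      [set v : R | (n < Num.truncn (v * k%:R))%N]).
  apply/seteqP; split => v /=.
    by move=> lv; exists (Num.truncn (v * k%:R)) => //=; rewrite leqnn ltnn.
  case=> n /= <- [h /negP]; rewrite -leqNgt => h'.
  by rewrite /leader; congr nth; apply/eqP; rewrite eqn_leq -/k h h'.
by apply: bigcup_measurable => n _; apply: measurableD => //; exact: mge.
Qed.

Lemma measurable_played (x : A -> R) (pi : {ffun A -> bool}) :
  measurable [set u : R | [ffun a => played x u a] = pi].
Proof.
have -> : [set u : R | [ffun a => played x u a] = pi] =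
  \big[setI/setT]_a [set u | played x u a = pi a].
  apply/seteqP; split => u /=.
    move=> <-; rewrite -bigcap_seq => a _ /=; by rewrite ffunE.
  rewrite -bigcap_seq => H; apply/ffunP => a; rewrite ffunE; apply: H => /=.
  exact: mem_index_enum.
apply: bigsetI_measurable => a _.
have m1 : measurable [set u : R | played x u a].
  have -> : [set u : R | played x u a] = `[cum x a, cum x a + x a[%classic.
    by apply/seteqP; split => u /=; rewrite in_itv.
  exact: measurable_itv.
case: (pi a) => //.
have -> : [set u : R | played x u a = false] = ~` [set u : R | played x u a].
  by apply/seteqP; split => u /=; [move=> ->|move/negP/negbTE].
exact: measurableC.
Qed.

(** Histories are stored latest outcome first, so the tail of a history is its past and [size] is
    the current time. *)
Definition state (h : seq outcome) : A -> R :=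
  foldr (fun o x => outcome_step x o) p0 h.

Fixpoint path_weight (h : seq outcome) : R :=
  if h is o :: h' then outcome_weight (state h') o * path_weight h' else 1.

Fixpoint paths (t : nat) : seq (seq outcome) :=
  if t is t'.+1 then [seq o :: h | h <- paths t', o <- enum outcome]
  else [:: [::]].

Lemma mem_paths t h : (h \in paths t) = (size h == t).
Proof.
elim: t h => [|t IH] h /=; first by rewrite inE; case: h.
apply/allpairsP/idP => [[[h' o] /= [h1 _ ->]]|]; first by rewrite /= eqSS -IH.
by case: h => // o h; rewrite /= eqSS -IH => hh; exists (h, o); rewrite mem_enum.
Qed.

Lemma uniq_paths t : uniq (paths t).
Proof.
elim: t => [//|t IH] /=; apply: allpairs_uniq => //; first exact: enum_uniq.
by move=> [h o] [h' o'] _ _ /= [-> ->].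
Qed.

Definition path_mean (t : nat) (F : seq outcome -> R) : R :=
  \sum_(h <- paths t) path_weight h * F h.

Lemma path_mean0 F : path_mean 0 F = F [::].
Proof. by rewrite /path_mean /= big_seq1 mul1r. Qed.

(** Tower property: condition on the first [t] outcomes and average over the next one. *)
Lemma path_meanS t F :
  path_mean t.+1 F =
  path_mean t (fun h => \sum_o outcome_weight (state h) o * F (o :: h)).
Proof.
rewrite /path_mean /= big_allpairs_dep; apply: eq_bigr => h _.
rewrite mulr_sumr big_enum /=; apply: eq_bigr => o _.
by rewrite mulrA [path_weight h * _]mulrC.
Qed.

(** * The law of the observed history and the Markov property *)

Section Law.
Variables (d : measure_display) (Omega : measurableType d).
Variable P : probability Omega R.
Variables (Rew : A -> nat -> Omega -> bool) (U V : nat -> Omega -> R).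
Hypothesis rewP : forall a t, bernoulli_rv P (r a) (Rew a t).
Hypothesis unifU : forall t, uniform01 P (U t).
Hypothesis unifV : forall t, uniform01 P (V t).
Hypothesis indep : mutually_independent P (samba_sources Rew U V).

Notation X := (samba alpha a0 p0 Rew U V).

Fixpoint history (t : nat) (w : Omega) : seq outcome :=
  if t is t'.+1 then
    observe (X t' w) (U t' w) (V t' w) (fun a => Rew a t' w) :: history t' w
  else [::].

Lemma size_history t w : size (history t w) = t.
Proof. by elim: t => //= t ->. Qed.

Lemma state_history t w : state (history t w) = X t w.
Proof. by elim: t => //= t IH; rewrite samba_stepE IH. Qed.

Definition source_time (i : samba_index A) : nat :=
  match i with inl (inl (_, t)) => t | inl (inr t) => t | inr t => t end.

Definition source_cell (x : A -> R) (o : outcome) (i : samba_index A) : set Omega :=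
  match i with
  | inl (inl (a, t)) => [set w | Rew a t w = o.2 a]
  | inl (inr t) => [set w | [ffun a => played x (U t w) a] = o.1.2]
  | inr t => [set w | leader a0 x (V t w) = o.1.1]
  end.

Definition sources_at (t : nat) : seq (samba_index A) :=
  inr t :: inl (inr t) :: [seq inl (inl (a, t)) | a <- enum A].

Fixpoint sources_before (t : nat) : seq (samba_index A) :=
  if t is t'.+1 then sources_at t' ++ sources_before t' else [::].

(** Each source is confronted with the outcome of its own time. The state in force there is computed
    from the fixed path, not from [w], so the cell constrains this single source. *)
Fixpoint path_cell (h : seq outcome) (i : samba_index A) : set Omega :=
  if h is o :: h' then
    if source_time i == size h' then source_cell (state h') o i
    else path_cell h' i
  else setT.

Lemma mem_sources_beforeS t i : (i \in sources_before t.+1) =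
  (i \in sources_at t) || (i \in sources_before t).
Proof. exact: mem_cat. Qed.

Lemma source_time_at t i : i \in sources_at t -> source_time i = t.
Proof.
rewrite !inE => /or3P[/eqP->|/eqP->|/mapP[a _ ->]] //.
Qed.

Lemma source_time_before t i : i \in sources_before t -> (source_time i < t)%N.
Proof.
elim: t => // t IH; rewrite mem_sources_beforeS => /orP[/source_time_at -> //|/IH/ltnW//].
Qed.

Lemma uniq_sources_before t : uniq (sources_before t).
Proof.
elim: t => // t IH.
rewrite -[sources_before _]/(sources_at t ++ sources_before t) cat_uniq IH andbT.
apply/andP; split.
  rewrite /sources_at /= inE /= map_inj_uniq ?enum_uniq ?andbT; last by move=> a b [].
  by apply/andP; split; apply/negP; [case/mapP|case/mapP].
apply/hasPn => i /source_time_before it; apply/negP => /source_time_at iE.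
by rewrite iE ltnn in it.
Qed.

Lemma source_cell_in x o i : samba_sources Rew U V i (source_cell x o i).
Proof.
case: i => [[[a t]|t]|t] /=.
- by exists [set o.2 a].
- exists [set u : R | [ffun a => played x u a] = o.1.2] => //.
  exact: measurable_played.
- exists [set v : R | leader a0 x v = o.1.1] => //.
  exact: measurable_leader.
Qed.

Lemma path_cell_in t h i : size h = t -> i \in sources_before t ->
  samba_sources Rew U V i (path_cell h i).
Proof.
elim: h t => [|o h IH] [|t] // [ht]; rewrite mem_sources_beforeS [path_cell _ _]/=.
case: eqP => [_ _|nt]; first exact: source_cell_in.
case/orP => [/source_time_at it|]; last exact: IH.
by rewrite it ht in nt.
Qed.

Lemma measurable_source i (B : set Omega) : samba_sources Rew U V i B -> measurable B.
Proof.
case: i => [[[a t]|t]|t] /= [C mC <-].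
- have [mr _] := rewP a t.
  have mb (b : bool) : measurable (Rew a t @^-1` [set b]).
    case: b; first exact: mr.
    rewrite [X in measurable X](_ : _ = ~` [set w | Rew a t w]).
      exact: measurableC.
    by apply/seteqP; split => w /=; [move=> ->|move/negP/negbTE].
  rewrite [X in measurable X](_ : _ = \bigcup_(b in C) (Rew a t @^-1` [set b])).
    by apply: fin_bigcup_measurable => [|b _]; [exact: finite_finset|exact: mb].
  by apply/seteqP; split => w /=; [move=> Cw; exists (Rew a t w)|case=> b Cb ->].
- by rewrite -[X in measurable X]setTI; case: (unifU t) => mU _; exact: mU.
- by rewrite -[X in measurable X]setTI; case: (unifV t) => mV _; exact: mV.
Qed.

(** Along a fixed path all states are deterministic, so following the path is a conjunction of
    conditions on single sources. This is the form to which independence applies. *)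
Lemma history_eq t h : size h = t ->
  [set w | history t w = h] = \bigcap_(i in [set` sources_before t]) path_cell h i.
Proof.
elim: t h => [|t IH] [|o h] //.
  by move=> _; apply/seteqP; split.
move=> [ht]; apply/seteqP; split => w.
  move=> /= hE; have hh : history t w = h by case: hE.
  have oE : observe (state h) (U t w) (V t w) (fun a => Rew a t w) = o.
    by rewrite -hh state_history; case: hE.
  have := IH h ht; move/seteqP => [/(_ w hh) Hw _] i ib.
  have {ib} : i \in sources_before t.+1 := ib.
  rewrite mem_sources_beforeS [path_cell _ _]/= => /orP[|].
    move=> it; rewrite (source_time_at it) ht eqxx.
    move: it; rewrite -oE !inE => /or3P[/eqP->|/eqP->|/mapP[a _ ->]] //=.
    by rewrite ffunE.
  move=> ib; rewrite ht ltn_eqF; first exact: Hw.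
  exact: source_time_before.
move=> Hw0.
have {Hw0} Hw i : i \in sources_before t.+1 -> path_cell (o :: h) i w := Hw0 i.
have hh : history t w = h.
  have := IH h ht; move/seteqP => [_ /(_ w)]; apply => i /= ib.
  have := Hw i; rewrite [path_cell _ _]/= mem_sources_beforeS ib orbT ht ltn_eqF; first exact.
  exact: source_time_before.
rewrite /= hh; congr (_ :: _); rewrite -state_history hh.
have Hc i : i \in sources_at t -> source_cell (state h) o i w.
  move=> it; have := Hw i; rewrite [path_cell _ _]/= mem_sources_beforeS it.
  by rewrite (source_time_at it) ht eqxx; exact.
case: o {Hw} Hc => [[s pi] rho] Hc; congr (_, _, _).
- by apply: (Hc (inr t)); rewrite inE eqxx.
- by apply: (Hc (inl (inr t))); rewrite !inE eqxx orbT.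
- apply/ffunP => a; rewrite ffunE; apply: (Hc (inl (inl (a, t)))).
  by rewrite !inE; apply/or3P/Or33/map_f; rewrite mem_enum.
Qed.

Lemma prob_source_cells x o t :
  (\prod_(i <- sources_at t) P (source_cell x o i) = (outcome_weight x o)%:E)%E.
Proof.
rewrite /sources_at !big_cons big_map /= /outcome_weight -mulrA !EFinM.
congr (_ * (_ * _))%E.
- by apply: uniform01_law => //; exact: measurable_leader.
- by apply: uniform01_law => //; exact: measurable_played.
rewrite /reward_weight -prodEFin big_enum /=; apply: eq_bigr => a _.
have [mr Pr] := rewP a t.
case: (o.2 a); first exact: Pr.
rewrite [X in P X](_ : _ = ~` [set w | Rew a t w]) ?probability_setC ?Pr //.
by apply/seteqP; split => w /=; [move=> ->|move/negP/negbTE].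
Qed.

Lemma measurable_history t h : measurable [set w | history t w = h].
Proof.
have [ht|ht] := eqVneq (size h) t; last first.
  rewrite [X in measurable X](_ : _ = set0) //; apply/seteqP; split => w //= hE.
  by rewrite -hE size_history eqxx in ht.
rewrite history_eq // bigcap_seq big_seq; apply: bigsetI_measurable => i ib.
exact: measurable_source (path_cell_in ht ib).
Qed.

(** Independence gives a product over all sources before [t]; grouping it by time gives one outcome
    weight per step. *)
Lemma prob_history t h : size h = t -> P [set w | history t w = h] = (path_weight h)%:E.
Proof.
move=> ht; rewrite history_eq // indep ?uniq_sources_before //; last first.
  by move=> i; exact: path_cell_in.
elim: h t ht => [|o h IH] [|t] //; first by rewrite big_nil.
move=> [ht]; rewrite big_cat [path_weight _]/= EFinM [LHS]/=; congr (_ * _)%E.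
  rewrite -(prob_source_cells _ _ t) big_seq [RHS]big_seq; apply: eq_bigr => i it.
  by rewrite (source_time_at it) ht eqxx.
rewrite -(IH t ht) big_seq [RHS]big_seq; apply: eq_bigr => i ib.
by rewrite ht ltn_eqF //; exact: source_time_before.
Qed.

(** The histories of length [t] partition the sample space into finitely many events, so any
    function of the history is simple and its integral is a finite sum. *)
Lemma history_decomp t (F : seq outcome -> R) w :
  F (history t w) =
  \sum_(h <- paths t) F h * \1_[set w | history t w = h] w.
Proof.
rewrite (bigD1_seq (history t w)) ?uniq_paths ?mem_paths ?size_history //=.
rewrite indicE mem_set // mulr1 big1_seq ?addr0 // => h /andP[/eqP nh _].
by rewrite indicE memNset ?mulr0 //= => hE; apply: nh.
Qed.

Lemma measurable_fun_history t (F : seq outcome -> R) :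
  measurable_fun setT (fun w => F (history t w)).
Proof.
rewrite (funext (history_decomp t F)); apply: measurable_sum => h.
apply: measurable_funM => //; apply: measurable_indic; exact: measurable_history.
Qed.

Lemma integral_history t (F : seq outcome -> R) : (forall h, 0 <= F h) ->
  (\int[P]_w (F (history t w))%:E)%E = (path_mean t F)%:E.
Proof.
move=> F0; under eq_integral do rewrite history_decomp -sumEFin.
rewrite ge0_integral_sum //; first last.
- by move=> h w _; rewrite lee_fin mulr_ge0 // indicE.
- move=> h; apply/measurable_EFinP; apply: measurable_funM => //.
  apply: measurable_indic; exact: measurable_history.
rewrite /path_mean -sumEFin big_seq [RHS]big_seq; apply: eq_bigr => h.
rewrite mem_paths => /eqP ht.
under eq_integral do rewrite EFinM.
have mh := measurable_history t h.
rewrite ge0_integralZl //; first last.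
- by rewrite lee_fin.
- by apply/measurable_EFinP; apply: measurable_indic.
rewrite integral_indic // setIT EFinM muleC; congr (_ * _)%E.
exact: prob_history.
Qed.

Lemma measurable_history_set t (B : set (seq outcome)) :
  measurable [set w | B (history t w)].
Proof.
have := measurable_fun_history t (\1_B) measurableT (measurable_set1 1).
rewrite setTI => mB.
rewrite [X in measurable X](_ : _ =
  (fun w => (\1_B (history t w) : R)) @^-1` [set 1]) //.
apply/seteqP; split => w /=; rewrite indicE.
  by move=> Bw; rewrite mem_set.
by move=> /eqP; rewrite pnatr_eq1 eqb1 inE.
Qed.

Lemma prob_history_set t (B : set (seq outcome)) :
  P [set w | B (history t w)] = (path_mean t (\1_B))%:E.
Proof.
rewrite -integral_history; last by move=> h; rewrite indicE.
have mB := measurable_history_set t B.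
transitivity (\int[P]_w (\1_[set w | B (history t w)] w)%:E)%E.
  by rewrite integral_indic // setIT.
by apply: eq_integral => w _.
Qed.

(** The constraint on the whole past of the chain, read from the history; it turns both sides of the
    Markov identity into path sums. *)
Fixpoint stays_in (B : nat -> set (A -> R)) (h : seq outcome) : Prop :=
  if h is o :: h' then stays_in B h' /\ B (size h) (state h) else B 0%N p0.

Lemma stays_in_history (B : nat -> set (A -> R)) t w :
  (forall s, (s <= t)%N -> B s (X s w)) <-> stays_in B (history t w).
Proof.
elim: t => [|t IH].
  by split=> [/(_ 0%N)|H [|s]] //; exact.
rewrite [stays_in _ _]/= -IH -[outcome_step _ _]/(state (history t.+1 w)).
rewrite state_history size_history; split=> [H|[H1 H2] s].
  by split=> [s st|]; apply: H => //; exact: leqW.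
by rewrite leq_eqVlt => /predU1P[->|]; [exact: H2|exact: H1].
Qed.

Lemma samba_markov_chain : (forall a, 0 <= r a <= 1) -> markov_chain P X.
Proof.
move=> r01.
have w0 x o : 0 <= outcome_weight x o.
  rewrite /outcome_weight !mulr_ge0 ?unif01_ge0 //.
  by apply: prodr_ge0 => a _; case: ifP => _; have := r01 a; lra.
(* The kernel is the image of the outcome law under the step; the Markov identity is then
   [path_meanS]. *)
exists (fun x B => \sum_o outcome_weight x o * \1_B (outcome_step x o)); split.
  by move=> x B; apply: sumr_ge0 => o _; rewrite mulr_ge0 // indicE.
move=> t B.
have setE s : [set w | forall s', (s' <= s)%N -> B s' (X s' w)] =
    [set w | stays_in B (history s w)].
  by apply/seteqP; split => w /= /stays_in_history.
rewrite !setE prob_history_set path_meanS.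
set S := [set w | stays_in B (history t w)].
have mS : measurable S by exact: measurable_history_set.
rewrite integral_mkcond.
pose F (h : seq outcome) := \1_(stays_in B : set _) h *
  \sum_o outcome_weight (state h) o * \1_(B t.+1) (outcome_step (state h) o).
transitivity (\int[P]_w (F (history t w))%:E)%E; last first.
  apply: eq_integral => w _; rewrite /F restrict_EFin /patch /= -state_history.
  have [Sw|Sw] := boolP (w \in S).
    by rewrite indicE mem_set ?mul1r //; move/set_mem: Sw.
  by rewrite indicE memNset ?mul0r //; move/negP: Sw; apply: contra_not => ?; exact: mem_set.
rewrite integral_history; last first.
  move=> h; rewrite mulr_ge0 ?indicE // sumr_ge0 // => o _.
  by rewrite mulr_ge0 // indicE.
congr (_%:E); rewrite /path_mean big_seq [RHS]big_seq; apply: eq_bigr => h.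
rewrite mem_paths => /eqP ht; congr (_ * _); rewrite /F mulr_sumr; apply: eq_bigr => o _.
rewrite mulrCA; congr (_ * _); rewrite !indicE -natrM mulnb; congr ((nat_of_bool _)%:R).
apply/idP/andP; rewrite !inE /= ht; exact.
Qed.

End Law.
End Paths.

(** * One-step means on the simplex *)

Section Kernel.
Variables (R : realType) (A : finType).
Variables (alpha : R -> R) (a0 : A) (r : A -> R).
Hypothesis cardA : (1 < #|A|)%N.
Hypothesis r01 : forall a, 0 <= r a <= 1.
Hypothesis alpha01 : forall q : R, 0 < q < 1 -> 0 < alpha q < 1.

Implicit Types x : A -> R.

Notation weight := (outcome_weight a0 r).
Notation step := (outcome_step alpha).

Definition in_simplex (x : A -> R) : Prop := (forall a, 0 < x a) /\ \sum_a x a = 1.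

Definition is_max (x : A -> R) (s : A) : Prop := forall b, x b <= x s.

Lemma simplex_sum2 x a b : in_simplex x -> a != b -> x a + x b <= 1.
Proof.
move=> [x0 <-] ab; rewrite (bigD1 a) //= (bigD1 b) 1?eq_sym //= addrA lerDl.
by apply: sumr_ge0 => c _; exact: ltW.
Qed.

Lemma simplex_lt1 x a : in_simplex x -> 0 < x a < 1.
Proof.
move=> xS; have [x0 _] := xS; rewrite x0 /=.
have /card_gt0P[b] : (0 < #|predC1 a|)%N.
  by rewrite -(ltn_add2l #|pred1 a|) cardC card1.
rewrite inE => ba; have := simplex_sum2 xS ba; have := x0 b; lra.
Qed.

Lemma lead_weight_ge0 x s : 0 <= lead_weight a0 x s.
Proof. exact: unif01_ge0. Qed.

Lemma sum_lead_weight x : \sum_s lead_weight a0 x s = 1.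
Proof.
rewrite /lead_weight (@unif01_fibers _ _ (leader a0 x) predT).
  by rewrite -unif01T; congr unif01; apply/seteqP; split.
by move=> t; exact: measurable_leader.
Qed.

(** For [v < 1] the index stays within the nonempty list of maximisers. A non-maximal leader thus
    requires [1 <= v], which has mass 0. *)
Lemma lead_weight_max x s : lead_weight a0 x s != 0 -> is_max x s.
Proof.
move=> ws b; apply/contraT; rewrite -ltNge => sb.
case/eqP: ws; apply: unif01_ge1; first exact: measurable_leader.
move=> v /= ls; rewrite leNgt; apply/negP => v1.
have sz : (0 < size (argmax_set x))%N.
  rewrite -has_predT; apply/hasP => /=.
  have [m _ Hm] := @arg_maxP _ _ _ a0 predT x erefl.
  exists m => //; rewrite mem_filter mem_enum andbT.
  by apply/forallP => c; exact: Hm.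
suff : s \in argmax_set x.
  by rewrite mem_filter => /andP[/forallP/(_ b)]; rewrite leNgt sb.
rewrite -ls /leader mem_nth //.
rewrite -[X in (_ < X)%N](prednK sz) ltnS truncn_le_nat prednK //.
by rewrite gtr_pMl // ltr0n.
Qed.

Lemma sum_play_weight x : \sum_(pi : {ffun A -> bool}) play_weight x pi = 1.
Proof.
rewrite /play_weight (@unif01_fibers _ _ (fun u => [ffun a => played x u a]) predT).
  by rewrite -unif01T; congr unif01; apply/seteqP; split.
by move=> t; exact: measurable_played.
Qed.

Lemma cum_ge0 x a : in_simplex x -> 0 <= cum x a.
Proof. by move=> [x0 _]; apply: sumr_ge0 => b _; exact: ltW. Qed.

Lemma cum_next x a b : in_simplex x -> (enum_rank a < enum_rank b)%N ->
  cum x a + x a <= cum x b.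
Proof.
move=> [x0 _] ab; rewrite /cum [leRHS](bigD1 a) //= [leLHS]addrC lerD2l.
rewrite [leRHS](bigID (fun c => (enum_rank c < enum_rank a)%N)) /=.
rewrite -[leLHS]addr0 lerD //; last by apply: sumr_ge0 => c _; exact: ltW.
rewrite le_eqVlt; apply/predU1P; left; apply: eq_bigl => c.
apply/idP/andP => [ca|[]//]; split=> //; rewrite (ltn_trans ca ab) /=.
by apply: contraTneq ca => ->; rewrite ltnn.
Qed.

Lemma cum_le1 x a : in_simplex x -> cum x a + x a <= 1.
Proof.
move=> [x0 <-]; rewrite /cum [leRHS](bigD1 a) //= [leLHS]addrC lerD2l.
rewrite [leRHS](bigID (fun c => (enum_rank c < enum_rank a)%N)) /=.
rewrite -[leLHS]addr0 lerD //; last by apply: sumr_ge0 => c _; exact: ltW.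
rewrite le_eqVlt; apply/predU1P; left; apply: eq_bigl => c.
apply/idP/andP => [ca|[]//]; split=> //.
by apply: contraTneq ca => ->; rewrite ltnn.
Qed.

Lemma sum_play_weight_arm x a : in_simplex x ->
  \sum_(pi : {ffun A -> bool} | pi a) play_weight x pi = x a.
Proof.
move=> xS; rewrite /play_weight.
rewrite (@unif01_fibers _ _ (fun u => [ffun a => played x u a])
  (fun pi : {ffun A -> bool} => pi a)); last first.
  by move=> t; exact: measurable_played.
transitivity (unif01 [set u | (cum x a <= u) && (u < cum x a + x a)]).
  by congr unif01; apply/seteqP; split => u /=; rewrite ffunE.
rewrite unif01_itv_co ?cum_ge0 ?cum_le1 ?lerDl //; last by have [/(_ a)/ltW] := xS.
by rewrite addrC addKr.
Qed.

(** The cells of distinct arms are disjoint, so no [u] realises a pattern that marks two of them. *)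
Lemma play_weight_single x pi a b : in_simplex x ->
  play_weight x pi != 0 -> pi a -> pi b -> a = b.
Proof.
move=> xS wpi pia pib; apply/eqP/contraT => ab; case/eqP: wpi.
rewrite /play_weight [X in unif01 X](_ : _ = set0) ?/unif01 ?set0I ?measure0 //.
apply/seteqP; split => u //= piE; move: pia pib; rewrite -piE !ffunE.
move=> /andP[a1 a2] /andP[b1 b2].
have : (enum_rank a < enum_rank b)%N || (enum_rank b < enum_rank a)%N.
  by rewrite -neq_ltn; apply: contra ab => /eqP/val_inj/enum_rank_inj ->.
by case/orP => /(cum_next xS); lra.
Qed.

Lemma reward_weight_ge0 (rho : {ffun A -> bool}) : 0 <= reward_weight r rho.
Proof. by apply: prodr_ge0 => a _; case: ifP => _; have := r01 a; lra. Qed.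

Lemma sum_reward_weight : \sum_(rho : {ffun A -> bool}) reward_weight r rho = 1.
Proof.
rewrite /reward_weight -(bigA_distr_bigA (fun a (b : bool) => if b then r a else 1 - r a)).
by apply: big1 => a _; rewrite big_bool /= addrC subrK.
Qed.

Lemma sum_reward_weight_arm a :
  \sum_(rho : {ffun A -> bool} | rho a) reward_weight r rho = r a.
Proof.
rewrite /reward_weight big_mkcond /=.
(* The indicator of [rho a] is moved into the factor of [a], so that the sum of products factorises
   over the arms. *)
pose G c (b : bool) : R := (if b then r c else 1 - r c) * (if c == a then b%:R else 1).
transitivity (\sum_(rho : {ffun A -> bool}) \prod_c G c (rho c)).
  apply: eq_bigr => rho _; rewrite /G big_split /= -big_mkcond /= big_pred1_eq.
  by case: (rho a); rewrite ?mulr1 ?mulr0.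
rewrite -bigA_distr_bigA (bigD1 a) //= big_bool /= /G eqxx mulr1 mulr0 addr0.
rewrite big1 ?mulr1 // => c /negbTE ca; rewrite big_bool /= ca !mulr1 addrC subrK //.
Qed.

Lemma outcome_weight_ge0 x o : 0 <= weight x o.
Proof. by rewrite !mulr_ge0 ?unif01_ge0 ?reward_weight_ge0. Qed.

Lemma outcome_weight_neq0 x o : in_simplex x -> weight x o != 0 ->
  is_max x o.1.1 /\ forall a b, wins o a -> wins o b -> a = b.
Proof.
move=> xS; rewrite /outcome_weight !mulf_eq0 !negb_or => /andP[/andP[wl wp] _].
split; first exact: lead_weight_max.
by move=> a b /andP[oa _] /andP[ob _]; exact: (play_weight_single xS wp).
Qed.

(** At most one arm wins, so the quantities of interest are affine in the win indicators, exactly or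
    as upper bounds, with coefficients depending on the leader. Averaging over arm and rewards
    replaces the indicator of [a] by [x a * r a]. *)
Lemma outcome_mean_affine x (c0 : A -> R) (c : A -> A -> R) : in_simplex x ->
  \sum_o weight x o * (c0 o.1.1 + \sum_a c o.1.1 a * (wins o a)%:R) =
  \sum_s lead_weight a0 x s * (c0 s + \sum_a c s a * (x a * r a)).
Proof.
move=> xS.
transitivity (\sum_s \sum_(pi : {ffun A -> bool}) \sum_(rho : {ffun A -> bool})
  lead_weight a0 x s * (play_weight x pi * reward_weight r rho *
   (c0 s + \sum_a c s a * (pi a && rho a)%:R))).
  rewrite pair_bigA pair_bigA /=; apply: eq_bigr => [[[s pi] rho] _] /=.
  by rewrite /outcome_weight /= !mulrA.
apply: eq_bigr => s _.
under eq_bigr do rewrite -mulr_sumr.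
rewrite -mulr_sumr; congr (_ * _).
transitivity (\sum_(pi : {ffun A -> bool}) play_weight x pi *
   (c0 s + \sum_a c s a * ((pi a)%:R * r a))).
  apply: eq_bigr => pi _; under eq_bigr do rewrite -mulrA mulrDr.
  rewrite -mulr_sumr; congr (_ * _); rewrite big_split /= -mulr_suml.
  rewrite sum_reward_weight mul1r; congr (_ + _).
  under eq_bigr do rewrite mulr_sumr.
  rewrite exchange_big /=; apply: eq_bigr => a _.
  under eq_bigr do rewrite mulrCA.
  rewrite -mulr_sumr; congr (_ * _); rewrite -sum_reward_weight_arm.
  rewrite [in RHS]big_mkcond /= mulr_sumr; apply: eq_bigr => rho _.
  by case: (pi a) (rho a) => [] []; rewrite /= ?mulr1 ?mulr0 ?mul1r ?mul0r.
under eq_bigr do rewrite mulrDr.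
rewrite big_split /= -mulr_suml sum_play_weight mul1r; congr (_ + _).
under eq_bigr do rewrite mulr_sumr.
rewrite exchange_big /=; apply: eq_bigr => a _.
under eq_bigr do rewrite mulrCA.
rewrite -mulr_sumr; congr (_ * _); rewrite -(sum_play_weight_arm a xS).
rewrite [in RHS]big_mkcond /= mulr_suml; apply: eq_bigr => pi _.
by case: (pi a); rewrite /= ?mul1r ?mul0r ?mulr0.
Qed.

Lemma sum_outcome_weight x : in_simplex x -> \sum_o weight x o = 1.
Proof.
move=> xS; have := outcome_mean_affine (fun=> 1) (fun _ _ => 0) xS.
have E (f : A -> R) : 1 + \sum_a 0 * f a = 1.
  by rewrite big1 ?addr0 // => a _; rewrite mul0r.
under eq_bigr do rewrite E mulr1.
move=> ->; under eq_bigr do rewrite (E (fun a => x a * r a)) mulr1.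
exact: sum_lead_weight.
Qed.

Lemma outcome_mean_wins x a : in_simplex x ->
  \sum_o weight x o * (wins o a)%:R = x a * r a.
Proof.
move=> xS; have := outcome_mean_affine (fun=> 0) (fun _ b => (b == a)%:R) xS.
have E (f : A -> R) : \sum_b (b == a)%:R * f b = f a.
  rewrite (bigD1 a) //= eqxx mul1r big1 ?addr0 // => b /negbTE ->.
  by rewrite mul0r.
under eq_bigr do rewrite add0r E.
move=> ->; under eq_bigr do rewrite add0r (E (fun b => x b * r b)).
by rewrite -mulr_suml sum_lead_weight mul1r.
Qed.

(** Outcomes with a non-maximal leader or two winners have weight 0, so the comparison may ignore
    them. *)
Lemma outcome_mean_le x (F G : outcome A -> R) : in_simplex x ->
  (forall o, is_max x o.1.1 -> (forall a b, wins o a -> wins o b -> a = b) ->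
    F o <= G o) ->
  \sum_o weight x o * F o <= \sum_o weight x o * G o.
Proof.
move=> xS FG; apply: ler_sum => o _.
have [->|wo] := eqVneq (weight x o) 0; first by rewrite !mul0r.
have [om o1] := outcome_weight_neq0 xS wo.
by rewrite ler_wpM2l ?outcome_weight_ge0 ?FG.
Qed.

Lemma lead_mean_le x (F G : A -> R) : 
  (forall s, is_max x s -> F s <= G s) ->
  \sum_s lead_weight a0 x s * F s <= \sum_s lead_weight a0 x s * G s.
Proof.
move=> FG; apply: ler_sum => s _.
have [->|ws] := eqVneq (lead_weight a0 x s) 0; first by rewrite !mul0r.
by rewrite ler_wpM2l ?lead_weight_ge0 // FG //; exact: lead_weight_max.
Qed.

Lemma max_not_leader_half x s b : in_simplex x -> is_max x s -> b != s -> x b <= 2^-1.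
Proof.
by move=> xS /(_ b) sm bs; have := simplex_sum2 xS bs; lra.
Qed.

(** Positivity uses [alpha < 1] twice. If the leader wins, another arm [a] loses the fraction
    [alpha (x a) * (x a / x s) < 1] of its mass. If another arm [b] wins, the leader loses
    [alpha (x b) * x b < x b <= x s]. *)
Lemma outcome_step_simplex x o : in_simplex x -> is_max x o.1.1 ->
  (forall a b, wins o a -> wins o b -> a = b) -> in_simplex (step x o).
Proof.
move=> xS om o1; have [x0 x1] := xS; set s := o.1.1 in om *; split; last first.
  rewrite (bigD1 s) //= /outcome_step eqxx -/s.
  rewrite [X in _ + X](eq_bigr (update alpha x o)) ?subrK //.
  by move=> a /negbTE; rewrite -/s => ->.
have al b : 0 < alpha (x b) < 1 by apply: alpha01; exact: simplex_lt1.
have noW b : wins o s -> b != s -> wins o b = false.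
  by move=> ws; apply: contra_neqF => wb; exact: o1.
have updE b : b != s -> update alpha x o b =
   x b + (alpha (x b) * x b * (wins o b)%:R - alpha (x b) * x b ^+ 2 / x s * (wins o s)%:R).
  by move=> bs; rewrite /update -/s; field; rewrite ?gt_eqF.
move=> a; rewrite /outcome_step -/s; case: eqVneq => [_|as_].
  rewrite (eq_bigr _ updE) big_split /= opprD addrA.
  have -> : 1 - \sum_(b | b != s) x b = x s.
    by rewrite -x1 (bigD1 s) //= addrK.
  have [ws|ws] := boolP (wins o s).
    rewrite ltr_wpDr // ?x0 // oppr_ge0; apply: sumr_le0 => b bs.
    rewrite noW // mulr0 mulr1 sub0r oppr_le0.
    have /andP[/ltW alb _] := al b.
    by rewrite !mulr_ge0 ?invr_ge0 ?exprn_ge0 // ltW.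
  have [b wb|nob] := pickP (wins o).
    have bs : b != s by apply: contraNneq ws => <-.
    rewrite (bigD1 b) //= wb mulr1 mulr0 subr0 big1 ?addr0.
      rewrite subr_gt0 (lt_le_trans _ (om b)) // gtr_pMl //.
      by case/andP: (al b).
    move=> c /andP[cs cb]; rewrite mulr0 subr0.
    rewrite [wins o c](_ : _ = false) ?mulr0 //.
    by apply: contra_neqF cb => wc; exact: o1.
  rewrite big1 ?subr0 // => b bs.
  by rewrite nob !mulr0 subrr.
rewrite updE //; have [ws|ws] := boolP (wins o s).
  rewrite noW // mulr0 mulr1 sub0r.
  have -> : x a - alpha (x a) * x a ^+ 2 / x s = x a * (1 - alpha (x a) * (x a / x s)).
    by field; rewrite gt_eqF.
  rewrite mulr_gt0 // subr_gt0 (le_lt_trans _ (proj2 (andP (al a)))) //.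
  by rewrite ger_pMr ?ler_pdivrMr ?mul1r //; case/andP: (al a).
have /andP[/ltW ala _] := al a.
by rewrite mulr0 subr0 ltr_wpDr // !mulr_ge0 // ltW.
Qed.

(** The increment of [x a0] when [s] leads and [a] wins. If [a0] itself leads, it collects what the
    others lose or pays what the winner gains. *)
Definition star_coef (x : A -> R) (s a : A) : R :=
  if s == a0 then
    if a == a0 then (\sum_(b | b != a0) alpha (x b) * x b ^+ 2) / x a0
    else - (alpha (x a) * x a)
  else if a == a0 then alpha (x a0) * x a0
  else if a == s then - (alpha (x a0) * x a0 ^+ 2 / x s) else 0.

(** The conditional mean increment of [x a0] given the leader [s]. *)
Definition star_drift (x : A -> R) (s : A) : R :=
  if s == a0 then \sum_(b | b != a0) alpha (x b) * x b ^+ 2 * (r a0 - r b)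
  else alpha (x a0) * x a0 ^+ 2 * (r a0 - r s).

Lemma star_stepE x o : in_simplex x ->
  step x o a0 = x a0 + \sum_a star_coef x o.1.1 a * (wins o a)%:R.
Proof.
move=> [x0 x1]; rewrite /outcome_step /star_coef; set s := o.1.1.
rewrite eq_sym; case: (eqVneq s a0) => [sE|ns].
  rewrite sE [in RHS](bigD1 a0) //= eqxx.
  rewrite -{1}x1 (bigD1 a0) //= /update -/s sE big_split /=.
  rewrite [X in _ + (_ + X)](eq_bigr (fun b => - (alpha (x b) * x b * (wins o b)%:R))); last first.
    by move=> b /negbTE ->; rewrite mulNr.
  rewrite [X in _ - (_ + X)](eq_bigr (fun b => alpha (x b) * x b * (wins o b)%:R -
      alpha (x b) * x b ^+ 2 * ((wins o a0)%:R / x a0))); last first.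
    by move=> b _; rewrite mulrBr; congr (_ - _); field; rewrite gt_eqF.
  rewrite sumrB -mulr_suml sumrN; field; by rewrite gt_eqF.
rewrite (bigD1 a0) //= eqxx (bigD1 s) //= (negbTE ns) eqxx big1 ?addr0.
  by rewrite /update -/s; field; rewrite !gt_eqF.
by move=> b /andP[/negbTE -> /negbTE ->]; rewrite mul0r.
Qed.

Lemma star_drift_mean x s : in_simplex x ->
  \sum_a star_coef x s a * (x a * r a) = star_drift x s.
Proof.
move=> [x0 _]; rewrite /star_coef /star_drift; case: eqP => [sE|/eqP ns].
  rewrite (bigD1 a0) //= eqxx.
  rewrite [X in _ + X](eq_bigr (fun b => - (alpha (x b) * x b ^+ 2 * r b))); last first.
    by move=> b /negbTE ->; ring.
  rewrite sumrN [RHS](eq_bigr (fun b => alpha (x b) * x b ^+ 2 * r a0 -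
    alpha (x b) * x b ^+ 2 * r b)); last by move=> b _; rewrite mulrBr.
  by rewrite sumrB -mulr_suml; congr (_ - _); field; rewrite gt_eqF.
rewrite (bigD1 a0) //= eqxx (bigD1 s) //= (negbTE ns) eqxx big1 ?addr0.
  by field; rewrite gt_eqF.
by move=> b /andP[/negbTE -> /negbTE ->]; rewrite mul0r.
Qed.

Definition mean_drift (x : A -> R) : R :=
  \sum_s lead_weight a0 x s * star_drift x s.

Lemma star_mean x : in_simplex x ->
  \sum_o weight x o * step x o a0 = x a0 + mean_drift x.
Proof.
move=> xS; under eq_bigr do rewrite star_stepE //.
rewrite (outcome_mean_affine (fun=> x a0)) //.
under eq_bigr do rewrite mulrDr star_drift_mean //.
by rewrite big_split /= -mulr_suml sum_lead_weight mul1r.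
Qed.

End Kernel.

(** * Path means and convergence *)

Section PathMeans.
Variables (R : realType) (A : finType).
Variables (alpha : R -> R) (a0 : A) (p0 r : A -> R).
Hypothesis cardA : (1 < #|A|)%N.
Hypothesis r01 : forall a, 0 <= r a <= 1.
Hypothesis alpha01 : forall q : R, 0 < q < 1 -> 0 < alpha q < 1.
Hypothesis p0S : in_simplex p0.
Implicit Types x : A -> R.

Notation weight := (outcome_weight a0 r).
Notation step := (outcome_step alpha).
Notation st := (state alpha p0).
Notation mean := (path_mean alpha a0 p0 r).
Notation drift := (mean_drift alpha a0 r).

(** Paths that leave the simplex have weight 0, so every comparison may assume a state in the
    simplex. *)
Lemma path_mean_le t (F G : seq (outcome A) -> R) :
  (forall h, size h = t -> in_simplex (st h) -> F h <= G h) ->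
  mean t F <= mean t G.
Proof.
elim: t F G => [|t IH] F G FG; first by rewrite !path_mean0; exact: FG.
rewrite !path_meanS; apply: IH => h ht hS.
apply: outcome_mean_le => // o om o1; apply: FG; first by rewrite /= ht.
exact: outcome_step_simplex.
Qed.

Lemma path_mean_eq t (F G : seq (outcome A) -> R) :
  (forall h, size h = t -> in_simplex (st h) -> F h = G h) ->
  mean t F = mean t G.
Proof.
by move=> FG; apply/le_anti/andP; split; apply: path_mean_le => h ht hS; rewrite FG.
Qed.

Lemma path_meanD t F G : mean t (fun h => F h + G h) = mean t F + mean t G.
Proof.
by rewrite /path_mean -big_split /=; apply: eq_bigr => h _; rewrite mulrDr.
Qed.

Lemma path_meanZ t c F : mean t (fun h => c * F h) = c * mean t F.
Proof. by rewrite /path_mean mulr_sumr; apply: eq_bigr => h _; rewrite mulrCA. Qed.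

Lemma path_mean_sum t (I : finType) (F : I -> seq (outcome A) -> R) :
  mean t (fun h => \sum_i F i h) = \sum_i mean t (F i).
Proof.
by rewrite /path_mean exchange_big /=; apply: eq_bigr => h _; rewrite mulr_sumr.
Qed.

Lemma path_mean_cst t c : mean t (fun=> c) = c.
Proof.
elim: t => [|t IH]; first by rewrite path_mean0.
rewrite path_meanS -[RHS]IH; apply: path_mean_eq => h _ hS.
by rewrite -mulr_suml sum_outcome_weight // mul1r.
Qed.

(** The Lyapunov argument, used with [- x a0], with the inverse of [x a0] and with the logarithmic
    regret potential: one-step bounds telescope. *)
Lemma path_mean_potential (Phi f : (A -> R) -> R) t :
  (forall x, in_simplex x ->
    \sum_o weight x o * Phi (step x o) <= Phi x + f x) ->
  mean t (fun h => Phi (st h)) <= Phi p0 + \sum_(s < t) mean s (fun h => f (st h)).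
Proof.
move=> Hf; elim: t => [|t IH]; first by rewrite path_mean0 big_ord0 addr0.
rewrite path_meanS big_ord_recr /= addrA.
apply: (@le_trans _ _ (mean t (fun h => Phi (st h) + f (st h)))).
  by apply: path_mean_le => h _ hS; exact: Hf.
by rewrite path_meanD lerD2r.
Qed.

(** * Drift under a gap, convergence in mean and a maximal inequality *)

Variable Delta : R.
Hypothesis Delta0 : 0 < Delta.
Hypothesis gap : forall a, a != a0 -> Delta <= r a0 - r a.

Lemma alpha_simplex x a : in_simplex x -> 0 < alpha (x a) < 1.
Proof. by move=> xS; apply: alpha01; exact: simplex_lt1. Qed.

Lemma star_drift_leader x : in_simplex x ->
  Delta * \sum_(b | b != a0) alpha (x b) * x b ^+ 2 <= star_drift alpha a0 r x a0.
Proof.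
move=> xS; rewrite /star_drift eqxx mulr_sumr; apply: ler_sum => b ba.
have /andP[al _] := alpha_simplex b xS; rewrite mulrC ler_wpM2l ?gap //.
by rewrite mulr_ge0 ?exprn_ge0 // ltW //; have [->] := xS.
Qed.

Lemma star_drift_other x s : in_simplex x -> s != a0 ->
  Delta * (alpha (x a0) * x a0 ^+ 2) <= star_drift alpha a0 r x s.
Proof.
move=> xS sa; rewrite /star_drift (negbTE sa).
have /andP[al _] := alpha_simplex a0 xS; rewrite mulrC ler_wpM2l ?gap //.
by rewrite mulr_ge0 ?exprn_ge0 // ltW //; have [->] := xS.
Qed.

Lemma star_drift_ge0 x s : in_simplex x -> 0 <= star_drift alpha a0 r x s.
Proof.
move=> xS; have [->|sa] := eqVneq s a0.
  apply: le_trans (star_drift_leader xS); rewrite mulr_ge0 ?(ltW Delta0) //.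
  apply: sumr_ge0 => b _; have /andP[al _] := alpha_simplex b xS.
  by rewrite mulr_ge0 ?exprn_ge0 // ltW //; have [->] := xS.
apply: le_trans (star_drift_other xS sa); have /andP[al _] := alpha_simplex a0 xS.
by rewrite !mulr_ge0 ?exprn_ge0 // ltW //; have [->] := xS.
Qed.

Lemma mean_drift_ge0 x : in_simplex x -> 0 <= drift x.
Proof.
by move=> xS; apply: sumr_ge0 => s _; rewrite mulr_ge0 ?lead_weight_ge0 ?star_drift_ge0.
Qed.

(** The drifts add up to the mean growth of [x a0], which stays below 1. *)
Lemma sum_mean_drift t : \sum_(s < t) mean s (fun h => drift (st h)) <= 1.
Proof.
have := @path_mean_potential (fun x => - x a0) (fun x => - drift x) t.
have -> : \sum_(s < t) mean s (fun h => - drift (st h)) =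
    - \sum_(s < t) mean s (fun h => drift (st h)).
  rewrite -sumrN; apply: eq_bigr => s _; rewrite -mulN1r -path_meanZ.
  by apply: path_mean_eq => h _ _; rewrite mulN1r.
move=> H; have {H} H := H _.
have : mean t (fun=> -1) <= mean t (fun h => - st h a0).
  by apply: path_mean_le => h _ /(simplex_lt1 cardA a0)/andP[_ h1]; rewrite lerN2 ltW.
rewrite path_mean_cst => H1.
have H2 : mean t (fun h => - st h a0) <=
    - p0 a0 - \sum_(s < t) mean s (fun h => drift (st h)).
  apply: H => x xS; under eq_bigr do rewrite mulrN.
  by rewrite sumrN star_mean // opprD.
have [p00 _] := p0S; have := p00 a0; lra.
Qed.

Lemma sum_wins_single (o : outcome A) (c : A -> R) b :
  (forall a b, wins o a -> wins o b -> a = b) -> wins o b ->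
  \sum_a c a * (wins o a)%:R = c b.
Proof.
move=> o1 wb; rewrite (bigD1 b) //= wb mulr1 big1 ?addr0 // => a ab.
by rewrite [wins o a](_ : _ = false) ?mulr0 //; apply: contra_neqF ab => wa; exact: o1.
Qed.

Lemma sum_wins_none (o : outcome A) (c : A -> R) :
  wins o =1 xpred0 -> \sum_a c a * (wins o a)%:R = 0.
Proof. by move=> w0; apply: big1 => a _; rewrite w0 mulr0. Qed.

Hypothesis alpha_mono : forall q q' : R, 0 < q -> q <= q' -> q' < 1 -> alpha q <= alpha q'.
Hypothesis alpha_vanish : forall e : R, 0 < e ->
  exists2 q0 : R, 0 < q0 & forall q : R, 0 < q < 1 -> e < alpha q -> q0 <= q.

Lemma max_ge_inv_card x s : in_simplex x -> is_max x s -> (#|A|%:R)^-1 <= x s.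
Proof.
move=> [_ x1] sm; have N0 : 0 < #|A|%:R :> R by rewrite ltr0n ltnW.
rewrite -(ler_pM2l N0) divff ?gt_eqF // mulr_natl -sumr_const -x1.
by apply: ler_sum => a _; exact: sm.
Qed.

(* When [x a0] is small, [alpha (x a0)] is below [Delta / 2] and the second
   order loss in the drift of [1 / x a0] is beaten by the gap. *)
Lemma inv_star_mean : exists2 C : R, 0 <= C & forall x, in_simplex x ->
  \sum_o weight x o * (step x o a0)^-1 <= (x a0)^-1 + C * drift x.
Proof.
have [q0 q00 Hq0] := alpha_vanish (divr_gt0 Delta0 (ltr0Sn R 1)).
(* A non-leader has mass at most 1/2, so by monotonicity [a1] bounds its learning rate away from
   1. *)
set a1 := alpha 2^-1.
have /andP[a10 a11] : 0 < a1 < 1 by apply: alpha01; lra.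
have b10 : 0 < 1 - a1 by lra.
have N0 : 0 < #|A|%:R :> R by rewrite ltr0n ltnW.
(* [C1] serves when [a0] leads, hence has mass at least [1 / #|A|]; [C2] serves when another arm
   leads and [x a0] is at least [q0]. *)
pose C1 := #|A|%:R ^+ 2 / ((1 - a1) * Delta) : R.
pose C2 := (q0 ^+ 2 * Delta * (1 - a1))^-1 : R.
have C10 : 0 < C1 by rewrite divr_gt0 ?exprn_gt0 ?mulr_gt0.
have C20 : 0 < C2 by rewrite invr_gt0 !mulr_gt0 // exprn_gt0.
exists (C1 + C2); first by rewrite ltW // addr_gt0.
move=> x xS; have [x0 _] := xS.
(* An upper bound for the increment of the inverse of [x a0] when [a] wins under leader [s]; it
   makes the nonlinear mean accessible to [outcome_mean_affine]. *)
pose c s a : R := if s == a0 then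
    if a == a0 then 0 else alpha (x a) * x a / (x a0 ^+ 2 * (1 - a1))
  else if a == a0 then - (alpha (x a0) / (x a0 * (1 + alpha (x a0))))
  else if a == s then alpha (x a0) / (x s * (1 - alpha (x a0))) else 0.
have al b : 0 < alpha (x b) < 1 by exact: alpha_simplex.
have alh s b : is_max x s -> b != s -> alpha (x b) <= a1.
  move=> sm bs; apply: alpha_mono => //; last lra.
  exact: max_not_leader_half bs.
have point s a : is_max x s -> (x a0 + star_coef alpha a0 x s a)^-1 <= (x a0)^-1 + c s a.
  move=> sm; rewrite /c /star_coef; case: eqP => [sE|/eqP ns].
    subst s; case: eqP => [aE|/eqP na].
      rewrite addr0 lef_pV2 ?posrE // ?lerDl.
        rewrite divr_ge0 ?(ltW (x0 _)) //; apply: sumr_ge0 => b _.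
        by have /andP[/ltW ? _] := al b; rewrite mulr_ge0 ?exprn_ge0 // ltW.
      rewrite ltr_wpDr // divr_ge0 ?(ltW (x0 _)) //; apply: sumr_ge0 => b _.
      by have /andP[/ltW ? _] := al b; rewrite mulr_ge0 ?exprn_ge0 // ltW.
    have ala := alh _ _ sm na; have /andP[al0 _] := al a.
    have H1 : alpha (x a) * x a <= a1 * x a0 by rewrite ler_pM // ?ltW.
    have H2 : x a0 * (1 - a1) <= x a0 - alpha (x a) * x a by lra.
    have H3 : 0 < x a0 * (1 - a1) by rewrite mulr_gt0.
    have H4 : 0 < x a0 - alpha (x a) * x a by lra.
    rewrite -subr_ge0.
    have -> : (x a0)^-1 + alpha (x a) * x a / (x a0 ^+ 2 * (1 - a1)) -
        (x a0 - alpha (x a) * x a)^-1 =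
      alpha (x a) * x a * (x a0 * a1 - alpha (x a) * x a) /
       (x a0 ^+ 2 * (1 - a1) * (x a0 - alpha (x a) * x a)).
      by field; rewrite !gt_eqF.
    rewrite divr_ge0 //; first by rewrite !mulr_ge0 ?(ltW (x0 _)) ?(ltW al0) // mulrC subr_ge0.
    by rewrite !mulr_ge0 ?exprn_ge0 ?(ltW (x0 _)) ?ltW.
  have /andP[al0 al1] := al a0.
  case: eqP => [aE|/eqP na].
    rewrite le_eqVlt; apply/predU1P; left; field.
    by rewrite !gt_eqF // ?addr_gt0 // ?mulr_gt0.
  case: eqP => [aE|/eqP nas]; last by rewrite !addr0.
  have H0 : 0 < x s - alpha (x a0) * x a0.
    rewrite subr_gt0 (lt_le_trans _ (sm a0)) // gtr_pMl //.
  have -> : x a0 - alpha (x a0) * x a0 ^+ 2 / x s =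
     x a0 * (x s - alpha (x a0) * x a0) / x s by field; rewrite gt_eqF.
  rewrite -subr_ge0.
  have -> : (x a0)^-1 + alpha (x a0) / (x s * (1 - alpha (x a0))) -
      (x a0 * (x s - alpha (x a0) * x a0) / x s)^-1 =
    alpha (x a0) ^+ 2 * (x s - x a0) /
      (x s * (1 - alpha (x a0)) * (x s - alpha (x a0) * x a0)).
    by field; rewrite !gt_eqF // ?subr_gt0 // ?mulr_gt0.
  rewrite divr_ge0 //; first by rewrite mulr_ge0 ?exprn_ge0 ?subr_ge0 ?sm // ltW.
  by rewrite !mulr_ge0 ?(ltW (x0 _)) ?(ltW H0) // subr_ge0 ltW.
apply: (@le_trans _ _ (\sum_o weight x o *
    ((x a0)^-1 + \sum_a c o.1.1 a * (wins o a)%:R))).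
  apply: outcome_mean_le => // o om o1; rewrite star_stepE //.
  have [b wb|nob] := pickP (wins o).
    by rewrite !(sum_wins_single _ o1 wb) point.
  by rewrite !sum_wins_none // !addr0.
rewrite (outcome_mean_affine a0 r (fun=> (x a0)^-1)) //.
have -> : (x a0)^-1 + (C1 + C2) * drift x =
  \sum_s lead_weight a0 x s * ((x a0)^-1 + (C1 + C2) * star_drift alpha a0 r x s).
  under eq_bigr do rewrite mulrDr mulrCA.
  by rewrite big_split /= -mulr_suml sum_lead_weight mul1r -mulr_sumr.
apply: lead_mean_le => s sm; rewrite lerD2l.
have d0 := star_drift_ge0 s xS.
have [sE|ns] := eqVneq s a0.
  subst s; apply: (@le_trans _ _ (C1 * star_drift alpha a0 r x a0)); last first.
    by rewrite ler_wpM2r // lerDl ltW.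
  apply: le_trans (ler_wpM2l (ltW C10) (star_drift_leader xS)).
  rewrite mulrA mulr_sumr (bigD1 a0) //= /c !eqxx mul0r add0r.
  apply: ler_sum => b /negbTE ->.
  have Hx : (x a0)^-1 <= #|A|%:R.
    by rewrite -[leRHS]invrK lef_pV2 ?posrE ?invr_gt0 // max_ge_inv_card.
  have -> : alpha (x b) * x b / (x a0 ^+ 2 * (1 - a1)) * (x b * r b) =
    alpha (x b) * x b ^+ 2 / (1 - a1) * (r b * ((x a0)^-1) ^+ 2).
    by field; rewrite !gt_eqF.
  have -> : C1 * Delta * (alpha (x b) * x b ^+ 2) =
    alpha (x b) * x b ^+ 2 / (1 - a1) * (1 * #|A|%:R ^+ 2).
    by rewrite /C1; field; rewrite !gt_eqF.
  have /andP[rb0 rb1] := r01 b; have /andP[/ltW alb _] := al b.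
  have xi0 : 0 <= (x a0)^-1 by rewrite invr_ge0 ltW.
  rewrite ler_wpM2l //; first by rewrite !mulr_ge0 ?exprn_ge0 ?invr_ge0 ?(ltW (x0 _)) // ltW.
  by rewrite ler_pM ?exprn_ge0 // lerXn2r // nnegrE ltW.
apply: (@le_trans _ _ (C2 * star_drift alpha a0 r x s)); last first.
  by rewrite ler_wpM2r // lerDr ltW.
have -> : \sum_a c s a * (x a * r a) =
    alpha (x a0) * (r s / (1 - alpha (x a0)) - r a0 / (1 + alpha (x a0))).
  have /andP[al0 al1] := al a0.
  rewrite (bigD1 a0) //= (bigD1 s) //= /c !(negbTE ns) !eqxx big1 ?addr0; last first.
    by move=> b /andP[/negbTE -> /negbTE ->]; rewrite mul0r.
  have e1 : 0 < 1 - alpha (x a0) by rewrite subr_gt0.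
  have e2 : 0 < 1 + alpha (x a0) by rewrite addr_gt0.
  by field; rewrite !gt_eqF.
have /andP[al0 al1] := al a0.
have /andP[rs0 rs1] := r01 s; have /andP[ra0 ra1] := r01 a0.
(* In the small case the bracket is nonpositive, since [alpha (x a0) * (r s + r a0)] is at most
   [Delta]. Otherwise [q0 <= x a0], and [C2] times the drift covers the bracket. *)
have [small|big] := leP (alpha (x a0)) (Delta / 2).
  apply: (@le_trans _ _ 0); last by rewrite mulr_ge0 // ltW.
  rewrite pmulr_rle0 // subr_le0 ler_pdivrMr ?subr_gt0 // mulrAC ler_pdivlMr ?addr_gt0 //.
  have := gap ns; nra.
have xq : q0 <= x a0 by apply: Hq0 => //; exact: simplex_lt1.
apply: le_trans (ler_wpM2l (ltW C20) (star_drift_other xS ns)).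
have -> : C2 * (Delta * (alpha (x a0) * x a0 ^+ 2)) =
  alpha (x a0) * ((1 - a1)^-1 * (x a0 / q0) ^+ 2).
  by rewrite /C2; field; rewrite !gt_eqF.
rewrite ler_pM2l //.
have ala : alpha (x a0) <= a1 by apply: (alh s); rewrite // eq_sym.
apply: (@le_trans _ _ (1 - a1)^-1).
  apply: (@le_trans _ _ (1 - alpha (x a0))^-1).
    rewrite lerBlDr -[leLHS]mul1r ler_wpDr ?divr_ge0 // ?addr_ge0 ?(ltW al0) //.
    by rewrite mul1r ler_piMl // invr_ge0 subr_ge0 ltW.
  by rewrite lef_pV2 ?posrE ?subr_gt0 // lerD2l lerN2.
rewrite ler_peMr ?invr_ge0 ?(ltW b10) // exprn_ege1 //.
by rewrite ler_pdivlMr // mul1r.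
Qed.

Lemma inv_star_bounded : exists2 M : R, 0 < M & forall t,
  mean t (fun h => (st h a0)^-1) <= M.
Proof.
have [C C0 HC] := inv_star_mean.
have [p00 _] := p0S; have p0a := p00 a0.
exists ((p0 a0)^-1 + C); first by rewrite ltr_pwDl // invr_gt0.
move=> t; apply: le_trans (path_mean_potential t HC) _.
rewrite lerD2l; under eq_bigr do rewrite path_meanZ.
by rewrite -mulr_sumr ler_piMr // sum_mean_drift.
Qed.

(** Either the deficit is at most [e], or [x a0 <= f] and the last term is at least 1, or the drift
    given the leader is bounded below by a positive constant. *)
Lemma star_deficit_le_drift (e f : R) : 0 < e < 1 -> 0 < f < 1 ->
  exists2 C : R, 0 <= C & forall x, in_simplex x ->
    1 - x a0 <= e + C * drift x + f / x a0.
Proof.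
move=> /andP[e0 e1] /andP[f0 f1].
have N0 : 0 < #|A|%:R :> R by rewrite ltr0n ltnW.
(* Pigeonhole: a deficit above [e] leaves some suboptimal arm with mass at least [e'], which drives
   the drift when [a0] leads. *)
pose e' : R := e / #|A|%:R.
have e'0 : 0 < e' by rewrite divr_gt0.
have e'1 : e' < 1.
  rewrite ltr_pdivrMr // mul1r (lt_le_trans e1) // ler1n ltnW //.
have /andP[ae _] := alpha01 (introT andP (conj e'0 e'1)).
have /andP[af _] := alpha01 (introT andP (conj f0 f1)).
pose c1 := Delta * (alpha e' * e' ^+ 2); pose c2 := Delta * (alpha f * f ^+ 2).
have c10 : 0 < c1 by rewrite mulr_gt0 // mulr_gt0 // exprn_gt0.
have c20 : 0 < c2 by rewrite mulr_gt0 // mulr_gt0 // exprn_gt0.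
exists (c1^-1 + c2^-1); first by rewrite ltW // addr_gt0 ?invr_gt0.
move=> x xS; have [x0 x1] := xS.
have fx0 : 0 <= f / x a0 by rewrite divr_ge0 // ltW.
suff H : 1 - x a0 - e - f / x a0 <= (c1^-1 + c2^-1) * drift x by lra.
set y := (X in X <= _).
have -> : y = \sum_s lead_weight a0 x s * y by rewrite -mulr_suml sum_lead_weight mul1r.
rewrite /mean_drift mulr_sumr.
under [leRHS]eq_bigr do rewrite mulrCA.
apply: lead_mean_le => s sm; rewrite {}/y.
have d0 := star_drift_ge0 s xS.
suff [H|[H|H]] : 1 - x a0 <= e \/ x a0 <= f \/
    (c1 <= star_drift alpha a0 r x s \/ c2 <= star_drift alpha a0 r x s).
- rewrite (@le_trans _ _ 0) //; first lra.
  by rewrite mulr_ge0 // ltW // addr_gt0 ?invr_gt0.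
- rewrite (@le_trans _ _ 0) //.
    have : 1 <= f / x a0 by rewrite ler_pdivlMr // mul1r.
    have := x0 a0; lra.
  by rewrite mulr_ge0 // ltW // addr_gt0 ?invr_gt0.
- apply: (@le_trans _ _ 1); first by have := x0 a0; lra.
  rewrite mulrDl; case: H => H.
    rewrite ler_wpDr ?mulr_ge0 ?invr_ge0 ?(ltW c20) //.
    by rewrite mulrC ler_pdivlMr // mul1r.
  rewrite ler_wpDl ?mulr_ge0 ?invr_ge0 ?(ltW c10) //.
  by rewrite mulrC ler_pdivlMr // mul1r.
have [|xe] := leP (1 - x a0) e; first by left.
have [|xf] := leP (x a0) f; first by right; left.
right; right; have [sE|ns] := eqVneq s a0; last first.
  right; apply: le_trans (star_drift_other xS ns).
  rewrite ler_pM2l // ler_pM ?exprn_ge0 ?(ltW af) ?(ltW f0) //.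
    by apply: alpha_mono => //; [exact: ltW|have /andP[] := simplex_lt1 cardA a0 xS].
  by rewrite lerXn2r // ?nnegrE ltW.
left; subst s; apply: le_trans (star_drift_leader xS); rewrite ler_pM2l //.
have [b /andP[ba xb]|nob] := pickP (fun b => (b != a0) && (e' <= x b)).
  rewrite (bigD1 b) //= ler_wpDr //.
    apply: sumr_ge0 => a _; have /andP[/ltW ala _] := alpha_simplex a xS.
    by rewrite mulr_ge0 ?exprn_ge0 // ltW.
  rewrite ler_pM ?exprn_ge0 ?(ltW ae) ?(ltW e'0) //.
    by apply: alpha_mono => //; have /andP[] := simplex_lt1 cardA b xS.
  by rewrite lerXn2r // ?nnegrE ltW.
exfalso; move: xe; rewrite -x1 (bigD1 a0) //= addrAC subrr add0r ltNge => /negP; apply.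
apply: (@le_trans _ _ (\sum_(b in A) e')); last first.
  by rewrite sumr_const -mulr_natr divfK // gt_eqF.
rewrite big_mkcond /=; apply: ler_sum => b _; case: ifP => ba; last exact: ltW.
by have := nob b; rewrite ba /= => /negbT; rewrite -ltNge => /ltW.
Qed.

Lemma mean_star_deficit_small (e : R) : 0 < e -> exists t, mean t (fun h => 1 - st h a0) < e.
Proof.
move=> e0; have [M M0 HM] := inv_star_bounded.
(* Each of the three terms is to cost at most [e / 4]; the minimum with 1/2 keeps both parameters
   below 1. *)
pose e1 := Num.min (e / 4) 2^-1; pose f1 := Num.min (e / 4 / M) 2^-1.
have e10 : 0 < e1 < 1.
  by rewrite lt_min gt_min; apply/andP; split; [apply/andP; split; lra|apply/orP; right; lra].
have f10 : 0 < f1 < 1.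
  rewrite lt_min gt_min; apply/andP; split; last by apply/orP; right; lra.
  by rewrite !divr_gt0 //=; lra.
have [C C0 HC] := star_deficit_le_drift e10 f10.
have [t Ht] : exists t, C * mean t (fun h => drift (st h)) < e / 4.
  pose c := e / 4 / (C + 1).
  have c0 : 0 < c by rewrite !divr_gt0 // ltr_wpDl.
  suff [t Ht] : exists t, mean t (fun h => drift (st h)) < c.
    exists t; have m0 : 0 <= mean t (fun h => drift (st h)).
      rewrite -[leLHS](path_mean_cst t) path_mean_le // => h _; exact: mean_drift_ge0.
    apply: (@le_lt_trans _ _ ((C + 1) * mean t (fun h => drift (st h)))).
      by rewrite ler_wpM2r // lerDl.
    by rewrite mulrC -ltr_pdivlMr // ltr_wpDl.
  apply: contrapT => /forallNP Hn.
  (* If every mean drift were at least [c], the first [T > 1 / c] of them would sum to more than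
     1. *)
  pose T := (Num.truncn c^-1).+1.
  have HT : c^-1 < T%:R by exact: truncnS_gt.
  have : \sum_(s < T) c <= 1.
    apply: le_trans (sum_mean_drift T); apply: ler_sum => s _.
    by rewrite leNgt; apply/negP/Hn.
  rewrite sumr_const card_ord -mulr_natr leNgt => /negP; apply.
  by rewrite mulrC -ltr_pdivrMr // mul1r.
exists t; apply: (@le_lt_trans _ _
    (mean t (fun h => e1 + C * drift (st h) + f1 * (st h a0)^-1))).
  by apply: path_mean_le => h _; exact: HC.
rewrite !path_meanD path_mean_cst !path_meanZ.
have : e1 <= e / 4 by rewrite ge_min lexx.
have : f1 * mean t (fun h => (st h a0)^-1) <= e / 4.
  apply: (@le_trans _ _ (f1 * M)); first by rewrite ler_wpM2l //; case/andP: f10 => /ltW.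
  by rewrite -ler_pdivlMr // ge_min lexx.
lra.
Qed.

(** The deficit reaches [e] at some time not before [t]: the recursion visits the suffixes of [h],
    that is, the earlier moments of the path. *)
Fixpoint exceeds (t : nat) (e : R) (h : seq (outcome A)) : bool :=
  ((t <= size h)%N && (e <= 1 - st h a0)) ||
  (if h is _ :: h' then exceeds t e h' else false).

Lemma exceeds_short t e h : (size h < t)%N -> exceeds t e h = false.
Proof.
elim: h => [|o h IH] /= ht; rewrite leqNgt ht //=.
by apply: IH; exact: ltnW.
Qed.

(** Doob's inequality for the nonnegative supermartingale [1 - x a0], with stopping written directly
    on paths. *)
Lemma maximal_inequality t m (e : R) : 0 < e ->
  mean (t + m) (fun h => (exceeds t e h)%:R) <= mean t (fun h => 1 - st h a0) / e.
Proof.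
move=> e0.
(* The scaled deficit, frozen at 1 once the level is reached; at the crossing it is already at least
   1, so the mean of [S] does not increase after time [t]. *)
pose S h : R := if exceeds t e h then 1 else (1 - st h a0) / e.
apply: (@le_trans _ _ (mean (t + m) S)).
  apply: path_mean_le => h _ hS; rewrite /S; case: ifP => //= _.
  by rewrite divr_ge0 ?(ltW e0) // subr_ge0 ltW //; case/andP: (simplex_lt1 cardA a0 hS).
elim: m => [|m IH].
  rewrite addn0 mulrC -path_meanZ; apply: path_mean_le => h ht _.
  rewrite /S; case: ifP => [|_]; last by rewrite mulrC.
  rewrite mulrC ler_pdivlMr // mul1r; case: h ht => [|o h] ht /=.
    by rewrite orbF => /andP[].
  by rewrite (exceeds_short _ (_ : (size h < t)%N)) -?ht // orbF => /andP[].
apply: le_trans IH; rewrite addnS path_meanS; apply: path_mean_le => h ht hS.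
rewrite {2}/S; case: ifP => exh.
  apply: (@le_trans _ _ (\sum_o weight (st h) o * 1)).
    apply: outcome_mean_le => // o _ _; rewrite /S /= exh orbT //.
  by under eq_bigr do rewrite mulr1; rewrite sum_outcome_weight.
apply: (@le_trans _ _ (\sum_o weight (st h) o * ((1 - step (st h) o a0) / e))).
  apply: outcome_mean_le => // o _ _; rewrite /S /= exh orbF.
  by case: ifP => // /andP[_ ?]; rewrite ler_pdivlMr // mul1r.
under eq_bigr do rewrite mulrA.
rewrite -mulr_suml ler_wpM2r ?invr_ge0 ?(ltW e0) //.
under eq_bigr do rewrite mulrBr mulr1.
rewrite sumrB sum_outcome_weight // star_mean //.
by have := mean_drift_ge0 hS; lra.
Qed.

End PathMeans.

(** * The regret potential *)

Section RegretPotential.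
Variables (R : realType) (A : finType).
Variables (alpha : R -> R) (a0 : A) (p0 r : A -> R).
Hypothesis cardA : (1 < #|A|)%N.
Hypothesis r01 : forall a, 0 <= r a <= 1.
Hypothesis alpha01 : forall q : R, 0 < q < 1 -> 0 < alpha q < 1.
Hypothesis p0S : in_simplex p0.
Variable Delta : R.
Hypothesis Delta0 : 0 < Delta.
Hypothesis gap : forall a, a != a0 -> Delta <= r a0 - r a.
Variables (T : nat) (kappa : R).
Hypothesis T0 : (0 < T)%N.
Hypothesis kappa0 : 0 < kappa.
Hypothesis alpha_low : forall q : R, T%:R^-1 <= q < 1 -> kappa <= alpha q.
Implicit Types x : A -> R.

Notation weight := (outcome_weight a0 r).
Notation step := (outcome_step alpha).
Notation st := (state alpha p0).
Notation mean := (path_mean alpha a0 p0 r).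
Notation drift := (mean_drift alpha a0 r).
Notation n := (#|A|.-1%:R : R).

Definition step_regret x : R := r a0 - \sum_a x a * r a.

(** With [y := 1 - x a0], the slope in [y] is [n / (kappa * Delta)] times [T / (n + T * y)]. Its
    product with the drift bound of [drift_half] is exactly [y - n / T]. *)
Definition potential x : R :=
  n / (kappa * Delta) * ln (1 + T%:R / n * (1 - x a0)).

Lemma pred_card_gt0 : 0 < n.
Proof. by rewrite ltr0n -ltnS prednK // ltnW. Qed.

Let Tpos : 0 < T%:R :> R. Proof. by rewrite ltr0n. Qed.

Lemma sum_others x : in_simplex x -> \sum_(b | b != a0) x b = 1 - x a0.
Proof. by move=> [_ <-]; rewrite [in RHS](bigD1 a0) //= addrAC subrr add0r. Qed.

Lemma step_regret_le x : in_simplex x -> step_regret x <= 1 - x a0.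
Proof.
move=> xS; have [x0 x1] := xS.
rewrite -sum_others // /step_regret -[r a0]mul1r -{1}x1 mulr_suml -sumrB.
rewrite (bigD1 a0) //= subrr add0r; apply: ler_sum => b _.
rewrite -mulrBr ler_piMr ?(ltW (x0 _)) //; have := r01 a0; have := r01 b; lra.
Qed.

(** Cauchy-Schwarz in tangent form: expand [(x b - m) ^+ 2 >= 0] at the average mass [m] of the
    suboptimal arms. *)
Lemma sum_squares_ge x : in_simplex x ->
  (1 - x a0) ^+ 2 / n - n / T%:R ^+ 2 <=
  \sum_(b | b != a0) (x b ^+ 2 - T%:R ^- 2).
Proof.
move=> xS; have n0 := pred_card_gt0; set m := (1 - x a0) / n.
have cardn : \sum_(b | b != a0) 1 = n.
  have -> : #|A|.-1 = #|predC1 a0| by rewrite -(cardC1 a0).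
  by rewrite -sumr_const; apply: eq_bigl => b; rewrite inE.
apply: (@le_trans _ _ (\sum_(b | b != a0)
   (2 * m * x b - (m ^+ 2 + T%:R ^- 2) * 1))).
  rewrite sumrB -!mulr_sumr cardn sum_others // le_eqVlt; apply/predU1P; left.
  by rewrite /m; field; rewrite !gt_eqF.
apply: ler_sum => b _; have := sqr_ge0 (x b - m); rewrite mulr1; nra.
Qed.

(** Above 1/2 the leader must be [a0]. Arms of mass at least [1 / T] have rate at least [kappa];
    subtracting [T%:R ^- 2] makes the terms of the lighter arms nonpositive, so they need no lower
    bound on the rate. *)
Lemma drift_half x : in_simplex x -> 2^-1 < x a0 ->
  kappa * Delta * ((1 - x a0) ^+ 2 / n - n / T%:R ^+ 2) <= drift x.
Proof.
move=> xS xh; have [x0 _] := xS.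
have : drift x >= Delta * \sum_(b | b != a0) alpha (x b) * x b ^+ 2.
  set y := (X in X <= _).
  have -> : y = \sum_s lead_weight a0 x s * y.
    by rewrite -mulr_suml sum_lead_weight mul1r.
  apply: lead_mean_le => s sm; have [->|sa] := eqVneq s a0.
    by rewrite {}/y; apply: star_drift_leader => //; exact: alpha01.
  have := max_not_leader_half xS sm (_ : a0 != s); rewrite eq_sym => /(_ sa).
  by rewrite leNgt xh.
apply: le_trans; rewrite [kappa * _]mulrC -mulrA ler_pM2l //.
apply: (le_trans (ler_wpM2l (ltW kappa0) (sum_squares_ge xS))).
rewrite mulr_sumr; apply: ler_sum => b ba.
have /andP[xb0 xb1] := simplex_lt1 cardA b xS.
have /andP[ab0 _] := alpha01 (introT andP (conj xb0 xb1)).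
have [xT|xT] := leP T%:R^-1 (x b).
  have kb : kappa <= alpha (x b) by apply: alpha_low; rewrite xT.
  apply: (@le_trans _ _ (kappa * x b ^+ 2)).
    by rewrite ler_pM2l // gerBl invr_ge0 exprn_ge0 // ltW.
  by rewrite ler_wpM2r // exprn_ge0 // ltW.
apply: (@le_trans _ _ 0); last by rewrite mulr_ge0 ?exprn_ge0 // ltW.
by rewrite pmulr_rle0 // subr_le0 -exprVn lerXn2r ?nnegrE ?(ltW xT) ?(ltW xb0).
Qed.

Lemma potential_step x : in_simplex x ->
  \sum_o weight x o * potential (step x o) <=
  potential x + (- step_regret x + (x a0 <= 2^-1)%R%:R + n / T%:R).
Proof.
move=> xS; have n0 := pred_card_gt0; have kd : 0 < kappa * Delta by rewrite mulr_gt0.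
set S := T%:R / n; have S0 : 0 < S by rewrite divr_gt0.
set y := 1 - x a0.
have /andP[xa0 xa1] := simplex_lt1 cardA a0 xS.
have y0 : 0 < y by rewrite subr_gt0.
have u0 : 0 < 1 + S * y by rewrite addr_gt0 // mulr_gt0.
set c := S / (1 + S * y).
have c0 : 0 < c by rewrite divr_gt0.
set K := n / (kappa * Delta); have K0 : 0 < K by rewrite divr_gt0.
(* Concavity: the logarithm lies below its tangent at the current [y], of slope [c], so the one-step
   mean involves only the drift. *)
have H1 : \sum_o weight x o * potential (step x o) <=
    \sum_o weight x o * (K * (ln (1 + S * y) + c * x a0) - K * c * step x o a0).
  apply: outcome_mean_le => // o om o1.
  have := outcome_step_simplex cardA alpha01 xS om o1.
  move=> /(simplex_lt1 cardA a0)/andP[s0 s1]; rewrite /potential -/K -/S.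
  set y' := 1 - step x o a0.
  have y'0 : 0 < y' by rewrite subr_gt0.
  have u'0 : 0 < 1 + S * y' by rewrite addr_gt0 // mulr_gt0.
  rewrite -mulrA -mulrBr ler_pM2l //.
  have -> : 1 + S * y' = (1 + S * y) * (1 + c * (x a0 - step x o a0)).
    by rewrite /c /y' /y; field; rewrite gt_eqF.
  have v0 : 0 < 1 + c * (x a0 - step x o a0).
    rewrite -(pmulr_rgt0 _ u0) [X in 0 < X](_ : _ = 1 + S * y') //.
    by rewrite /c /y' /y; field; rewrite gt_eqF.
  rewrite lnM ?posrE // -addrA lerD2l -mulrBr; apply: le_ln1Dx; lra.
apply: (le_trans H1).
under eq_bigr do rewrite mulrBr [_ * (K * c * _)]mulrCA.
rewrite sumrB -mulr_suml -mulr_sumr sum_outcome_weight // star_mean //.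
have -> : 1 * (K * (ln (1 + S * y) + c * x a0)) - K * c * (x a0 + drift x) =
    potential x - K * c * drift x by rewrite /potential -/K -/S -/y; ring.
rewrite lerD2l.
have reg := step_regret_le xS; have d0 := mean_drift_ge0 cardA alpha01 Delta0 gap xS.
have nT : 0 < n / T%:R by rewrite divr_gt0.
(* At or below 1/2 the potential does not increase in mean and the indicator pays for a regret of at
   most 1. Above 1/2 the drift bound pays. *)
have [xh|xh] := leP (x a0) 2^-1.
  have := mulr_ge0 (mulr_ge0 (ltW K0) (ltW c0)) d0.
  rewrite /=; lra.
have := drift_half xS xh; rewrite -/y => dh.
have : K * c * (kappa * Delta * (y ^+ 2 / n - n / T%:R ^+ 2)) <= K * c * drift x.
  by rewrite ler_pM2l // mulr_gt0.
have -> : K * c * (kappa * Delta * (y ^+ 2 / n - n / T%:R ^+ 2)) = y - n / T%:R.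
  have ud : 0 < n + T%:R * y by rewrite addr_gt0 // mulr_gt0.
  by rewrite /K /c /S; field; rewrite !gt_eqF.
rewrite /=; rewrite -/y in reg; lra.
Qed.

Lemma sum_regret_potential :
  \sum_(t < T) mean t (fun h => step_regret (st h)) <=
  n / (kappa * Delta) * ln (1 + T%:R / n) +
  \sum_(t < T) mean t (fun h => (st h a0 <= 2^-1)%R%:R) + n.
Proof.
have n0 := pred_card_gt0; have kd : 0 < kappa * Delta by rewrite mulr_gt0.
have S0 : 0 < T%:R / n by rewrite divr_gt0.
have K0 : 0 < n / (kappa * Delta) by rewrite divr_gt0.
have := path_mean_potential cardA r01 alpha01 p0S T potential_step.
have -> : \sum_(s < T) mean s (fun h => - step_regret (st h) + (st h a0 <= 2^-1)%R%:R + n / T%:R)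
  = - \sum_(t < T) mean t (fun h => step_regret (st h)) +
    \sum_(t < T) mean t (fun h => (st h a0 <= 2^-1)%R%:R) + n.
  rewrite -sumrN -big_split /=.
  rewrite -[X in _ = _ + X](_ : \sum_(t < T) n / T%:R = _); last first.
    by rewrite sumr_const card_ord -[LHS]mulr_natr divfK // gt_eqF.
  rewrite -big_split /=; apply: eq_bigr => t _.
  rewrite [LHS]path_meanD [X in X + _ = _]path_meanD.
  rewrite (path_mean_cst a0 cardA r01 alpha01 p0S); congr (_ + _ + _).
  by rewrite -[RHS]mulN1r -path_meanZ /path_mean; apply: eq_bigr => h _; rewrite mulN1r.
have : mean T (fun=> 0) <= mean T (fun h => potential (st h)).
  apply: path_mean_le => // h _ /(simplex_lt1 cardA a0)/andP[_ h1].
  by rewrite mulr_ge0 ?(ltW K0) // ln_ge0 // lerDl mulr_ge0 // ?ltW // subr_gt0.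
rewrite path_mean_cst //.
have : potential p0 <= n / (kappa * Delta) * ln (1 + T%:R / n).
  have /andP[q0 q1] := simplex_lt1 cardA a0 p0S.
  rewrite /potential ler_pM2l // ler_ln ?posrE ?addr_gt0 ?mulr_gt0 ?subr_gt0 ?invr_gt0 //.
  by rewrite lerD2l ler_piMr ?(ltW S0) // gerBl ltW.
lra.
Qed.

(** Since [1 + T / n] is [T * (1 / T + 1 / n)], the bound [ln (1 + z) <= z] gives [n * ln (1 + T /
    n) + (n - 1) <= n * ln T + n / T]. The last term is at most [ln T], which turns the factor [n]
    into [#|A|]; one unit of the additive [n] is left over. *)
Lemma sum_regret_le : kappa * Delta <= 1 -> n <= T%:R * ln (T%:R : R) ->
  \sum_(t < T) mean t (fun h => step_regret (st h)) <=
  #|A|%:R / (kappa * Delta) * ln T%:R +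
  \sum_(t < T) mean t (fun h => (st h a0 <= 2^-1)%R%:R) + 1.
Proof.
move=> kd1 nT; apply: (le_trans sum_regret_potential).
have n0 := pred_card_gt0; have kd : 0 < kappa * Delta by rewrite mulr_gt0.
have n1 : 1 <= n by rewrite ler1n -ltnS prednK // ltnW.
have -> : #|A|%:R = n + 1 :> R by rewrite natr1 prednK // ltnW.
set k := kappa * Delta in kd kd1 *.
have H : ln (1 + T%:R / n) <= ln T%:R + (T%:R^-1 + n^-1 - 1).
  have -> : 1 + T%:R / n = T%:R * (1 + (T%:R^-1 + n^-1 - 1)) :> R.
    by field; rewrite !gt_eqF.
  have Ti : 0 < T%:R^-1 :> R by rewrite invr_gt0.
  have ni : 0 < n^-1 by rewrite invr_gt0.
  rewrite lnM ?posrE //; last lra.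
  by rewrite lerD2l; apply: le_ln1Dx; lra.
have H1 : n * ln (1 + T%:R / n) + (n - 1) <= (n + 1) * ln T%:R.
  have : n * ln (1 + T%:R / n) <= n * (ln T%:R + (T%:R^-1 + n^-1 - 1)).
    by rewrite ler_pM2l.
  have -> : n * (ln T%:R + (T%:R^-1 + n^-1 - 1)) = n * ln T%:R + n / T%:R + 1 - n.
    by field; rewrite !gt_eqF.
  have : n / T%:R <= ln T%:R by rewrite ler_pdivrMr // mulrC.
  lra.
have H2 : n - 1 <= (n - 1) / k.
  by rewrite ler_pdivlMr // ler_piMr // subr_ge0.
have : (n * ln (1 + T%:R / n) + (n - 1)) / k <= (n + 1) * ln T%:R / k.
  by rewrite ler_pM2r ?invr_gt0.
rewrite mulrDl => H3.
rewrite mulrAC [(n + 1) / k * _]mulrAC; lra.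
Qed.

End RegretPotential.

(** * The learning-rate function *)

Section SambaAlpha.
Variables (R : realType) (beta : R).
Hypothesis beta01 : 0 < beta <= 1.
Let alpha := @samba_alpha R beta.

Lemma ln_shift_gt1 (q : R) : 0 < q < 1 -> 1 < ln (expR 1 - ln q).
Proof.
move=> q01; have lq : ln q < 0 by exact: ln_lt0.
rewrite -ltr_expR lnK ?posrE; first by rewrite ltrDl oppr_gt0.
by rewrite subr_gt0 (lt_trans lq) // expR_gt0.
Qed.

Lemma samba_alpha01 (q : R) : 0 < q < 1 -> 0 < alpha q < 1.
Proof.
move=> /ln_shift_gt1 l1; have /andP[b0 b1] := beta01.
have l0 : 0 < ln (expR 1 - ln q) by exact: lt_trans l1.
rewrite divr_gt0 //= ltr_pdivrMr // mul1r; exact: le_lt_trans l1.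
Qed.

Lemma samba_alpha_mono (q q' : R) : 0 < q -> q <= q' -> q' < 1 -> alpha q <= alpha q'.
Proof.
move=> q0 qq' q'1; have /andP[b0 b1] := beta01.
have q'0 : 0 < q' by exact: lt_le_trans qq'.
have q01 : 0 < q < 1 by rewrite q0 (le_lt_trans qq').
have q'01 : 0 < q' < 1 by rewrite q'0.
have l1 := ln_shift_gt1 q01; have l2 := ln_shift_gt1 q'01.
have lq : ln q < 0 by exact: ln_lt0.
have lq' : ln q' < 0 by exact: ln_lt0.
have e0 := expR_gt0 (1 : R).
rewrite ler_pM2l // lef_pV2 ?posrE; [|exact: lt_trans l1|exact: lt_trans l2].
rewrite ler_ln ?posrE ?subr_gt0; [|exact: lt_trans e0|exact: lt_trans e0].
by rewrite lerD2l lerN2 ler_ln ?posrE.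
Qed.

Lemma samba_alpha_vanish (e : R) : 0 < e ->
  exists2 q0 : R, 0 < q0 & forall q : R, 0 < q < 1 -> e < alpha q -> q0 <= q.
Proof.
(* From [e < alpha q] follows [expR 1 - ln q < expR (beta / e)]; dropping [expR 1] gives this
   witness. *)
move=> e0; exists (expR (- expR (beta / e))); first exact: expR_gt0.
move=> q q01; have /andP[q0 q1] := q01; have l1 := ln_shift_gt1 q01.
have lq : ln q < 0 by exact: ln_lt0.
have l0 : 0 < ln (expR 1 - ln q) by exact: lt_trans l1.
have ex0 := expR_gt0 (1 : R).
rewrite ltr_pdivlMr // mulrC -ltr_pdivlMr // -ltr_expR lnK ?posrE; last first.
  by rewrite subr_gt0 (lt_trans lq).
by move=> H; rewrite -[leRHS](lnK (q0 : q \in Num.pos)) ler_expR; lra.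
Qed.

(** Monotonicity down to the mass [1 / T]; this is the source of the iterated logarithm in the
    regret bound. *)
Lemma samba_alpha_low (T : nat) (q : R) : (1 < T)%N -> T%:R^-1 <= q < 1 ->
  beta / ln (expR 1 + ln T%:R) <= alpha q.
Proof.
move=> T1 /andP[Tq q1].
have T0 : 0 < T%:R :> R by rewrite ltr0n ltnW.
have := samba_alpha_mono _ Tq q1; rewrite /alpha /samba_alpha lnV ?posrE // opprK.
by apply; rewrite invr_gt0.
Qed.

End SambaAlpha.

(** * The SAMBA process *)

Section SambaLaw.
Variables (R : realType) (A : finType) (d : measure_display).
Variables (Omega : measurableType d) (P : probability Omega R).
Variables (alpha : R -> R) (a0 : A) (p0 r : A -> R).
Variables (Rew : A -> nat -> Omega -> bool) (U V : nat -> Omega -> R).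
Hypothesis cardA : (1 < #|A|)%N.
Hypothesis r01 : forall a, 0 <= r a <= 1.
Hypothesis alpha01 : forall q : R, 0 < q < 1 -> 0 < alpha q < 1.
Hypothesis p0S : in_simplex p0.
Hypothesis rewP : forall a t, bernoulli_rv P (r a) (Rew a t).
Hypothesis unifU : forall t, uniform01 P (U t).
Hypothesis unifV : forall t, uniform01 P (V t).
Hypothesis indep : mutually_independent P (samba_sources Rew U V).

Notation X := (samba alpha a0 p0 Rew U V).
Notation hist := (history alpha a0 p0 Rew U V).
Notation st := (state alpha p0).
Notation mean := (path_mean alpha a0 p0 r).

Lemma prob_samba t (Q : pred (A -> R)) :
  P [set w | Q (X t w)] = (mean t (fun h => (Q (st h))%:R))%:E.
Proof.
have -> : [set w | Q (X t w)] = [set w | [set h | Q (st h)] (hist t w)].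
  by apply/seteqP; split => w /=; rewrite state_history.
rewrite (prob_history_set _ _ _ rewP unifU unifV indep); congr (_%:E).
rewrite /path_mean; apply: eq_bigr => h _; rewrite indicE.
by congr (_ * (nat_of_bool _)%:R); apply/idP/idP; rewrite inE.
Qed.

(** This holds only almost surely: a tie-break value outside [[0, 1)] can select a leader that is
    not maximal. *)
Lemma samba_in_simplex t : P.-negligible [set w | ~ in_simplex (X t w)].
Proof.
exists [set w | `[< ~ in_simplex (X t w) >]]; split.
- have -> : [set w | `[< ~ in_simplex (X t w) >]] =
      [set w | [set h | ~ in_simplex (st h)] (hist t w)].
    by apply/seteqP; split => w /=; rewrite state_history; [move/asboolP|move/asboolP].
  exact: (measurable_history_set _ _ _ rewP unifU unifV).
- rewrite (prob_samba t (fun x => `[< ~ in_simplex x >])); congr (_%:E).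
  rewrite -[RHS](path_mean_cst a0 cardA r01 alpha01 p0S t).
  apply: path_mean_eq => // h _ hS; case: asboolP => //.
- by move=> w /= ?; apply/asboolP.
Qed.

Lemma integral_gain T :
  (\int[P]_w (\sum_(t < T) \sum_a samba_gain alpha a0 p0 Rew U V t w a)%:E)%E =
  (\sum_(t < T) mean t (fun h => \sum_a st h a * r a))%:E.
Proof.
(* The gain at time [t] is read from the latest outcome of the history at time [t.+1]. *)
pose F a (h : seq (outcome A)) : R := if h is o :: _ then (wins o a)%:R else 0.
have F0 a h : 0 <= F a h by case: h.
have gainE t a w : samba_gain alpha a0 p0 Rew U V t w a = F a (hist t.+1 w).
  by rewrite /samba_gain /= /wins /= !ffunE.
have mgain t a : measurable_fun setT (fun w => (samba_gain alpha a0 p0 Rew U V t w a)%:E).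
  apply/measurable_EFinP; under eq_fun do rewrite gainE.
  exact: (measurable_fun_history _ _ _ rewP unifU unifV).
have gain0 t a w : (0 <= (samba_gain alpha a0 p0 Rew U V t w a)%:E)%E.
  by rewrite gainE lee_fin.
under eq_integral do rewrite -sumEFin.
rewrite ge0_integral_sum //; first last.
- by move=> t w _; rewrite -sumEFin; apply: sume_ge0.
- by move=> t; under eq_fun do rewrite -sumEFin; apply: emeasurable_sum.
rewrite -sumEFin; apply: eq_bigr => t _.
under eq_integral do rewrite -sumEFin.
rewrite ge0_integral_sum // path_mean_sum -sumEFin; apply: eq_bigr => a _.
under eq_integral do rewrite gainE.
rewrite (integral_history _ _ _ rewP unifU unifV indep) // path_meanS; congr (_%:E).
by apply: path_mean_eq => // h _ hS; rewrite /F outcome_mean_wins.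
Qed.

Variable Delta : R.
Hypothesis Delta0 : 0 < Delta.
Hypothesis gap : forall a, a != a0 -> Delta <= r a0 - r a.
Hypothesis alpha_mono : forall q q' : R, 0 < q -> q <= q' -> q' < 1 -> alpha q <= alpha q'.
Hypothesis alpha_vanish : forall e : R, 0 < e ->
  exists2 q0 : R, 0 < q0 & forall q : R, 0 < q < 1 -> e < alpha q -> q0 <= q.

Lemma exceeds_history t e n m w : (t <= m <= n)%N -> e <= 1 - X m w a0 ->
  exceeds alpha a0 p0 t e (hist n w).
Proof.
move=> /andP[tm mn] em; elim: n mn => [|n IH].
  rewrite leqn0 => /eqP m0; subst m; move: tm; rewrite leqn0 => /eqP ->.
  by rewrite /= em.
rewrite leq_eqVlt => /predU1P[mE|mn].
  (* Naming the head lets [exceeds] unfold by one level; the default of [head] is never reached. *)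
  have -> : hist n.+1 w = head (a0, [ffun=> false], [ffun=> false]) (hist n.+1 w)
    :: hist n w by [].
  rewrite [exceeds _ _ _ _ _ _]/= -[outcome_step _ _ _]/(st (hist n.+1 w)).
  by rewrite state_history size_history -mE tm em.
by rewrite /= IH // orbT.
Qed.

(** For each [t] the event lies in the increasing union over [n] of the crossings in [[t, t + n]].
    By continuity from below and the maximal inequality that union has probability at most the mean
    deficit at [t] over [e], which is arbitrarily small for a suitable [t]. *)
Lemma exceeds_io_negligible (e : R) : 0 < e ->
  P.-negligible [set w | forall n, exists2 m, (n <= m)%N & e <= 1 - X m w a0].
Proof.
move=> e0; pose F t n := [set w | exceeds alpha a0 p0 t e (hist (t + n) w)].
have mF t n : measurable (F t n).
  exact: (measurable_history_set _ _ _ rewP unifU unifV (t + n)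
    [set h | exceeds alpha a0 p0 t e h]).
have mB t : measurable (\bigcup_n F t n) by apply: bigcup_measurable => n _; exact: mF.
have PB t : (P (\bigcup_n F t n) <= (mean t (fun h => 1 - st h a0) / e)%:E)%E.
  have cv : (P \o F t) n @[n --> \oo] --> P (\bigcup_n F t n).
    apply: nondecreasing_cvg_mu => //.
    move=> n n' nn'; apply/subsetPset => w; rewrite /F /=.
    elim: n' nn' => [|n' IH]; first by rewrite leqn0 => /eqP ->.
    rewrite leq_eqVlt => /predU1P[-> //|nn'] /IH; rewrite ltnS in nn'.
    by move=> /(_ nn') H; rewrite addnS /= H orbT.
  rewrite -(cvg_lim _ cv) //; apply: lime_le; first by apply/cvg_ex; eexists; exact: cv.
  apply: nearW => n /=.
  rewrite (prob_history_set _ _ _ rewP unifU unifV indep (t + n)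
    [set h | exceeds alpha a0 p0 t e h]) lee_fin.
  rewrite (le_trans _ (maximal_inequality cardA r01 alpha01 p0S Delta0 gap t n e0)) //.
  rewrite le_eqVlt; apply/predU1P; left; rewrite /path_mean; apply: eq_bigr => h _.
  by rewrite indicE; congr (_ * (nat_of_bool _)%:R); apply/idP/idP; rewrite inE.
exists (\bigcap_t \bigcup_n F t n); split.
- exact: bigcapT_measurable.
- apply/eqP; rewrite eq_le measure_ge0 andbT; apply/lee_addgt0Pr => f f0.
  rewrite add0e.
  have [t ht] := mean_star_deficit_small cardA r01 alpha01 p0S Delta0 gap alpha_mono
    alpha_vanish (mulr_gt0 f0 e0).
  apply: (@le_trans _ _ (P (\bigcup_n F t n))).
    apply: le_measure; rewrite ?inE //; first exact: bigcapT_measurable.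
    exact: bigcap_inf.
  by apply: (le_trans (PB t)); rewrite lee_fin ler_pdivrMr // ltW.
- move=> w /= Hw t _; have [m tm em] := Hw t.
  exists (m - t)%N => //; rewrite /F /= subnKC //.
  by apply: exceeds_history em; rewrite tm leqnn.
Qed.

Lemma samba_cvg : {ae P, forall w, X n w a0 @[n --> \oo] --> (1 : R)}.
Proof.
(* Failure of convergence is covered by the countable family of thresholds [1 / (k + 1)] together
   with the null events of leaving the simplex. *)
apply: (@negligibleS _ _ _ P ((\bigcup_k [set w | forall n,
    exists2 m, (n <= m)%N & k.+1%:R^-1 <= 1 - X m w a0]) `|`
    \bigcup_t [set w | ~ in_simplex (X t w)])); last first.
  apply: negligibleU; apply: negligible_bigcup => k; last exact: samba_in_simplex.
  by apply: exceeds_io_negligible; rewrite invr_gt0.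
move=> w /=; apply: contra_notP => /not_orP[H1 H2].
have Sw t : in_simplex (X t w).
  by apply: contrapT => Hn; apply: H2; exists t.
apply/cvgrPdist_lt => e e0.
have [k _ /(_ _ (leqnn k)) /= Hk] := near_infty_natSinv_lt (PosNum e0).
have [n Hn] : exists n, forall m, (n <= m)%N -> 1 - X m w a0 < k.+1%:R^-1.
  apply: contrapT => /forallNP Hn; apply: H1; exists k => //= n.
  apply: contrapT => /forall2NP Hm; apply: (Hn n) => m nm.
  by rewrite ltNge; apply/negP => ?; case: (Hm m).
exists n => // m /= nm.
have /andP[_ x1] := simplex_lt1 cardA a0 (Sw m).
by rewrite gtr0_norm ?subr_gt0 // (lt_trans (Hn m nm)).
Qed.

End SambaLaw.

(** * Numerical bounds and the final assembly *)

Lemma expR1_le3 (R : realType) : expR 1 <= 3 :> R.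
Proof.
(* The sixth power of [expR 6^-1 <= 6 / 5] is below 3. *)
have h : 1 - 6^-1 <= expR (- 6^-1) :> R by exact: expR_ge1Dx.
have e0 := expR_gt0 (- 6^-1 : R).
have : expR (6^-1) <= 6 / 5 :> R.
  rewrite -[6^-1]opprK expRN -[leRHS]invrK lef_pV2 ?posrE ?invr_gt0 ?divr_gt0 //.
  by apply: le_trans h; lra.
rewrite [X in _ -> expR X <= _](_ : 1 = 6^-1 * 6%:R); last by field.
rewrite expRM_natr => h2.
apply: (@le_trans _ _ ((6 / 5) ^+ 6)); last by lra.
by rewrite lerXn2r // nnegrE ?expR_ge0 // divr_ge0.
Qed.

(** For [3 <= T] the logarithm is at least 1, so [T <= T * ln T <= N <= N * ln T]. For [T = 2] the
    bound [ln 2 >= 1 / 2] is just enough. *)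
Lemma regret_trivial_regime (R : realType) (N T : nat) :
  (1 < T)%N -> T%:R * ln (T%:R : R) <= N%:R ->
  T%:R <= N.+1%:R * ln (T%:R : R) + 1.
Proof.
move=> T1 TN; have T2 : 2 <= T%:R :> R by rewrite ler_nat.
have T0 : 0 < T%:R :> R by rewrite ltr0n ltnW.
have l0 : 2^-1 <= ln (T%:R : R).
  have := @le_ln1Dx R (T%:R^-1 - 1); rewrite addrCA subrr addr0 lnV ?posrE //.
  have Ti : T%:R^-1 <= 2^-1 :> R by rewrite lef_pV2 ?posrE.
  have Ti0 : 0 < T%:R^-1 :> R by rewrite invr_gt0.
  by move=> /(_ ltac:(lra)); lra.
rewrite -natr1; have [T3|T3] := leqP 3 T.
  have l1 : 1 <= ln (T%:R : R).
    by rewrite -ler_expR lnK ?posrE // (le_trans (expR1_le3 R)) // ler_nat.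
  have TN' : T%:R <= N%:R :> R.
    by apply: le_trans TN; rewrite -[leLHS]mulr1 ler_pM2l.
  have : N%:R <= N%:R * ln (T%:R : R) by rewrite ler_peMr.
  lra.
have -> : T%:R = 2 :> R by congr (_%:R); apply/eqP; rewrite eqn_leq -ltnS T3 T1.
have TE : T = 2%N by apply/eqP; rewrite eqn_leq -ltnS T3 T1.
rewrite TE in TN l0; nra.
Qed.

Theorem theorem3 (R : realType) (A : finType) (d : measure_display)
  (Omega : measurableType d) (P : probability Omega R)
  (r : A -> R) (astar : A) (p0 : A -> R) (beta : R)
  (Rew : A -> nat -> Omega -> bool) (U V : nat -> Omega -> R) :
  (1 < #|A|)%N ->
  (forall a, 0 <= r a <= 1) ->
  (forall a, a != astar -> r a < r astar) ->
  (forall a, 0 < p0 a) -> \sum_a p0 a = 1 ->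
  0 < beta <= 1 ->
  (forall a t, bernoulli_rv P (r a) (Rew a t)) ->
  (forall t, uniform01 P (U t)) ->
  (forall t, uniform01 P (V t)) ->
  mutually_independent P (samba_sources Rew U V) ->
  let alpha := samba_alpha beta in
  let p := samba alpha astar p0 Rew U V in
  let Delta := r astar - \big[Num.max/0]_(a | a != astar) r a in
  let Q := (\sum_(0 <= t <oo) P [set w | (p t w astar <= 2^-1)%R])%E in
  let Rg := fun T : nat =>
    ((r astar * T%:R)%:E
     - \int[P]_w (\sum_(t < T) \sum_a samba_gain alpha astar p0 Rew U V t w a)%:E)%E in
  [/\ markov_chain P p,
      {ae P, forall w, p n w astar @[n --> \oo] --> (1 : R)} &
      forall T : nat,
        (Rg T <= ((#|A|%:R / (beta * Delta)) * ln (T%:R : R)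
                   * ln (expR 1 + ln (T%:R : R)))%:E + Q + 1)%E].
Proof.
move=> cardA r01 r_lt p00 p0sum beta01 rewP unifU unifV indep alpha p Delta Q Rg.
have p0S : in_simplex p0 by [].
have alpha01 := samba_alpha01 beta01.
have /andP[b0 b1] := beta01.
have gap a : a != astar -> Delta <= r astar - r a.
  by move=> aa; rewrite lerD2l lerN2; apply: le_bigmax_cond.
have Delta0 : 0 < Delta.
  rewrite subr_gt0; apply: bigmax_lt => //.
  (* The maximum starts from 0, so [0 < r astar] must be shown too; a second arm, with nonnegative
     mean, provides it. *)
  have /card_gt0P[b] : (0 < #|predC1 astar|)%N.
    by rewrite -(ltn_add2l #|pred1 astar|) cardC card1.
  rewrite inE => ba; apply: le_lt_trans (r_lt b ba); by case/andP: (r01 b).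
have Delta1 : Delta <= 1.
  rewrite lerBlDr (@le_trans _ _ 1) //; first by case/andP: (r01 astar).
  by rewrite lerDl; exact: bigmax_ge_id.
split.
- exact: (samba_markov_chain _ _ _ rewP unifU unifV indep r01).
- exact: (samba_cvg cardA r01 alpha01 p0S rewP unifU unifV indep Delta0 gap
    (samba_alpha_mono beta01) (samba_alpha_vanish beta)).
move=> T; rewrite /Rg (integral_gain astar cardA r01 alpha01 p0S rewP unifU unifV indep).
have Q0 : (0 <= Q)%E by apply: nneseries_ge0.
set G := \sum_(t < T) _.
have G0 : 0 <= G.
  apply: sumr_ge0 => t _; rewrite -[leLHS](path_mean_cst astar cardA r01 alpha01 p0S t).
  apply: path_mean_le => // h _ [h0 _]; apply: sumr_ge0 => a _.
  by rewrite mulr_ge0 // ?(ltW (h0 a)) //; case/andP: (r01 a).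
have trivial_regret : r astar * T%:R - G <= T%:R.
  rewrite lerBlDr ler_wpDr // ler_piMl //; by case/andP: (r01 astar).
set l := ln (expR 1 + ln T%:R).
(* The regret never exceeds [T]; this settles [T <= 1] and the range where the number of arms is
   large against [T * ln T]. *)
have easy : T%:R <= #|A|%:R / (beta * Delta) * ln T%:R * l + 1 ->
    ((r astar * T%:R)%:E - G%:E <=
     (#|A|%:R / (beta * Delta) * ln T%:R * l)%:E + Q + 1)%E.
  move=> H; apply: (@le_trans _ _ (#|A|%:R / (beta * Delta) * ln T%:R * l + 1)%:E).
    by rewrite -EFinB lee_fin (le_trans trivial_regret).
  by rewrite EFinD -addeA leeD2l // addeC leeDl.
have [T1|T1] := leqP T 1.
  apply: easy.
  (* This covers [T = 0] as well, where [ln 0] is 0 by convention; the additive 1 then suffices. *)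
  have -> : ln (T%:R : R) = 0.
    by case: T T1 {G G0 trivial_regret l} => [|[|]] // _; rewrite ?ln1 // ln0.
  by rewrite mulr0 mul0r add0r lern1.
have T0 : 0 < T%:R :> R by rewrite ltr0n ltnW.
have lT0 : 0 <= ln (T%:R : R) by rewrite ln_ge0 // ler1n ltnW.
have l1 : 1 <= l.
  rewrite /l -{1}(expRK 1) ler_ln ?posrE ?expR_gt0 ?lerDl //.
  by rewrite ltr_pwDl // expR_gt0.
have l0 : 0 < l by exact: lt_le_trans l1.
have bD0 : 0 < beta * Delta by rewrite mulr_gt0.
have bD1 : beta * Delta <= 1 by rewrite mulr_ile1 // ltW.
(* The learning rate at mass [1 / T], as in [samba_alpha_low]. *)
pose kappa := beta / l; have kappa0 : 0 < kappa by rewrite divr_gt0.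
have kE : #|A|%:R / (kappa * Delta) * ln T%:R = #|A|%:R / (beta * Delta) * ln T%:R * l.
  by rewrite /kappa; field; rewrite !gt_eqF.
have kD1 : kappa * Delta <= 1.
  rewrite /kappa mulrAC ler_pdivrMr // mul1r; exact: le_trans l1.
have cardE : (#|A|.-1.+1 = #|A|)%N by rewrite prednK // ltnW.
have [nT|/ltW nT] := leP (#|A|.-1%:R : R) (T%:R * ln (T%:R : R)); last first.
  apply: easy; apply: (le_trans (regret_trivial_regime T1 nT)).
  rewrite cardE lerD2r -kE mulrAC ler_peMr //; first by rewrite mulr_ge0.
  by rewrite invf_ge1 // mulr_gt0.
have := sum_regret_le cardA r01 alpha01 p0S Delta0 gap (ltnW T1) kappa0
  (fun q => @samba_alpha_low R beta beta01 T q T1) kD1 nT.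
rewrite kE.
have -> : \sum_(t < T) path_mean alpha astar p0 r t
    (fun h => step_regret astar r (state alpha p0 h)) = r astar * T%:R - G.
  have -> : r astar * T%:R = \sum_(t < T) r astar.
    by rewrite sumr_const card_ord mulr_natr.
  rewrite /G -sumrB; apply: eq_bigr => t _.
  rewrite -[r astar](path_mean_cst astar cardA r01 alpha01 p0S t) -mulN1r -path_meanZ.
  by rewrite -path_meanD /path_mean; apply: eq_bigr => h _; rewrite mulN1r.
set S := \sum_(t < T) _ => H.
(* [S] is a partial sum of the series [Q]; the comparison is in the extended reals, so an infinite
   [Q] is covered. *)
have SQ : (S%:E <= Q)%E.
  rewrite /S -sumEFin -(big_mkord xpredT (fun t => (path_mean alpha astar p0 r t
     (fun h => (state alpha p0 h astar <= 2^-1)%R%:R))%:E)).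
  apply: le_trans (nneseries_lim_ge T _) => //.
  apply: lee_sum => t _.
  by rewrite -(prob_samba alpha astar p0 rewP unifU unifV indep t (fun x => x astar <= 2^-1)).
apply: (@le_trans _ _ (#|A|%:R / (beta * Delta) * ln T%:R * l + S + 1)%:E).
  by rewrite -EFinB lee_fin.
by rewrite 2!EFinD leeD2r // leeD2l.
Qed.
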